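(* Let $\varphi\in L^1(\mathbb{R})$ be real-valued, and let $g:\mathbb{R}\to\mathbb{C}$ be a Lipschitz continuous function with $g(0)=0$. For $N\in\mathbb{N}$ let $K_N(\varphi)$ be the Hermitian $N\times N$ matrix $$K_N(\varphi)=\{k(n,m)\}_{n,m=1}^N,\qquad k(n,m)=\frac{1}{\sqrt{nm}}\,\widehat\varphi\left(\log\tfrac{n}{m}\right).$$ Then $$\lim_{N\to\infty}(\log N)^{-1}\operatorname{Tr} g(K_N(\varphi))=\frac{1}{2\pi}\int_{-\infty}^\infty g(\varphi(t))\,dt.$$
   Context: The Fourier transform is normalized as $\widehat\varphi(u)=\frac{1}{2\pi}\int_{-\infty}^\infty \varphi(t)e^{-itu}\,dt$. The matrix $g(K_N(\varphi))$ is defined by the functional calculus for Hermitian matrices, so $\operatorname{Tr} g(K_N(\varphi))=\sum_{j=1}^N g(\lambda_j)$, where $\lambda_1,\dots,\lambda_N$ are the eigenvalues of $K_N(\varphi)$ counted with multiplicity. *)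

(* Defs.v *)
From mathcomp Require Import all_boot all_order all_algebra spectral complex.
From mathcomp Require Import all_classical all_reals all_analysis.

Set Implicit Arguments.
Unset Strict Implicit.
Unset Printing Implicit Defensive.

Import Order.TTheory GRing.Theory Num.Theory.
Import numFieldNormedType.Exports.

Local Open Scope classical_set_scope.
Local Open Scope ring_scope.
Local Open Scope complex_scope.

Section Definitions.
Context {R : realType}.
Implicit Types (phi : R -> R) (g f : R -> R[i]).

(* The norm on the left is the modulus of R[i], which takes values in R[i];
   the library predicate [lipschitz _] requires both spaces to be normed
   modules over the same field, which R and R[i] are not. *)
Definition clipschitz g : Prop :=
  exists L : R, forall x y : R, `|g x - g y| <= (L * `|x - y|)%:C.

Definition cintegral f : R[i] :=
  (\int[lebesgue_measure]_(t in [set: R]) complex.Re (f t))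
  +i* (\int[lebesgue_measure]_(t in [set: R]) complex.Im (f t)).

(* e^(i x) for real x *)
Definition expi (x : R) : R[i] := cos x +i* sin x.

Definition fourier phi (u : R) : R[i] :=
  ((2 * pi)^-1)%:C * cintegral (fun t => (phi t)%:C * expi (- (t * u))).

(* Indices in 'I_N start at 0, hence the successors. *)
Definition Kmx phi (N : nat) : 'M[R[i]]_N :=
  \matrix_(n < N, m < N)
    (((Num.sqrt (n.+1%:R * m.+1%:R))^-1)%:C
     * fourier phi (ln (n.+1%:R / m.+1%:R))).

(* Functional calculus, meant for Hermitian A: there A is unitarily
   diagonalized by spectralmx A, and the entries of spectral_diag A are real,
   so that taking real parts loses nothing. *)
Definition hermfun g (N : nat) (A : 'M[R[i]]_N) : 'M[R[i]]_N :=
  invmx (spectralmx A)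
  *m diag_mx (map_mx (fun z : R[i] => g (complex.Re z)) (spectral_diag A))
  *m spectralmx A.

Lemma RintegralN_setT (h : R -> R) :
  \int[lebesgue_measure]_(t in [set: R]) (- h t)
  = - \int[lebesgue_measure]_(t in [set: R]) h t.
Proof.
rewrite /Rintegral [in RHS]integralE [in LHS]integralE.
have -> : (fun t => (- h t)%:E) = (\- (EFin \o h))%E by [].
rewrite funeposN funenegN; set a := integral _ _ _; set b := integral _ _ _.
by case: a b => [a| |] [b| |] //=; rewrite ?oppr0// opprB.
Qed.

Lemma conjc_scale (a : R) (z : R[i]) : (a%:C * z)^*%C = a%:C * z^*%C.
Proof. by case: z => x y; simpc. Qed.

Lemma fourierN phi u : fourier phi (- u) = (fourier phi u)^*%C.
Proof.
rewrite /fourier conjc_scale; congr (_ * _).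
rewrite /cintegral /=; congr (_ +i* _).
  apply: eq_Rintegral => t _ /=.
  by rewrite !mul0r !subr0 mulrN !cosN.
rewrite -RintegralN_setT; apply: eq_Rintegral => t _ /=.
by rewrite !mul0r !addr0 mulrN opprK sinN mulrN opprK.
Qed.

Lemma Kmx_herm phi N : Kmx phi N \is hermsymmx.
Proof.
apply/is_hermitianmxP; rewrite expr0 scale1r; apply/matrixP => n m.
have conjE (z : R[i]) : Num.conj z = z^*%C by [].
rewrite !mxE conjE conjc_scale [(m.+1%:R * _)]mulrC; congr (_ * _).
rewrite -fourierN; congr (fourier phi _).
by rewrite -lnV ?posrE ?divr_gt0 ?ltr0n// invf_div.
Qed.

Lemma char_poly_herm N (A : 'M[R[i]]_N) : A \is hermsymmx ->
  char_poly A = \prod_(j < N) ('X - (spectral_diag A 0 j)%:P).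
Proof.
move=> /hermitian_normalmx/orthomx_spectralP {1}->.
set P := spectralmx A; have Pu : P \in unitmx by exact: spectral_unit.
transitivity (char_poly (diag_mx (spectral_diag A))).
  rewrite /char_poly; set D := diag_mx _.
  have -> : char_poly_mx (invmx P *m D *m P) =
      map_mx polyC (invmx P) *m char_poly_mx D *m map_mx polyC P.
    rewrite /char_poly_mx mulmxBr mulmxBl !map_mxM; congr (_ - _).
    by rewrite mul_mx_scalar -scalemxAl -map_mxM mulVmx// map_mx1 scalemx1.
  rewrite !det_mulmx mulrC mulrA -det_mulmx -map_mxM mulmxV// map_mx1 det1.
  by rewrite mul1r.
rewrite char_poly_trig ?diag_mx_is_trig//; apply: eq_bigr => j _.
by rewrite mxE eqxx mulr1n.
Qed.

Lemma tr_hermfun g N (A : 'M[R[i]]_N) :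
  \tr (hermfun g A) = \sum_(j < N) g (complex.Re (spectral_diag A 0 j)).
Proof.
rewrite /hermfun mxtrace_mulC mulmxA mulmxV ?spectral_unit// mul1mx.
by rewrite mxtrace_diag; apply: eq_bigr => j _; rewrite mxE.
Qed.

End Definitions.

(* Main.v *)
(** The matrix K_N(phi) is the superposition (2 pi)^-1 \int phi(t) v_t v_t^*
    dt of the rank one matrices of v_t = (n^(-1/2 - i t))_n, and |v_t|^2 is
    the harmonic number H_N ~ log N for every t. The matrix (2 pi)^-1 \int
    e^(-e|t|) v_t v_t^* dt has the entries P(log n - log m) / sqrt(n m), where
    P is a Poisson kernel of mass one: Schur's test bounds it by the identity
    once the first few indices are damped (Bessel's inequality), while its
    quadratic form at v_0 is asymptotic to H_N, so that |<v_s, v_t>|^2 / (2 pi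
    H_N) is an approximate identity in t. For ramps (x - a)^+ with a >= 0 both
    bounds on Tr (K_N(phi) - a)^+ then follow in the manner of Berezin and
    Lieb: the upper one by testing the spectral decomposition against v_t and
    using convexity, the lower one from the trial matrix (2 pi)^-1 \int chi(t)
    v_t v_t^* dt, where 0 <= chi <= 1 approximates the indicator of phi > a.
    Ramps of phi and of -phi span the piecewise linear functions vanishing at
    0, and a Lipschitz g with g(0) = 0 differs from such a function by at most
    another combination of ramps whose integral along phi is small. *)

Require Import Defs.
From mathcomp Require Import all_boot all_order all_algebra spectral complex.
From mathcomp Require Import all_classical all_reals all_analysis.
From mathcomp Require Import measurable_realfun ring lra.

Set Implicit Arguments.
Unset Strict Implicit.
Unset Printing Implicit Defensive.

Import Order.TTheory GRing.Theory Num.Theory.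
Import numFieldNormedType.Exports.

Local Open Scope classical_set_scope.
Local Open Scope ring_scope.
Local Open Scope complex_scope.

(** * Integrals over the real line *)

(** The weight cannot be identically one: the integral of v_t v_t^* over the line diverges on the
    diagonal. The exponential weight makes it finite, but the Poisson matrix then samples a
    convolution on the uneven grid log n, and its weighted row sums are only bounded by 1 + (P(0) +
    1/2)/n. The factor n/(n + C) with C >= P(0) + 1/2 removes the excess; as the sum of 1/n^2
    converges, this costs O(1) against H_N. Since P(0) = 1/(pi e), the constants blow up as e tends
    to 0. Hence e stays fixed while N grows, and estimates have the form d H_N + K with K
    independent of N. Only thresholds a >= 0 occur: other ramps do not vanish at 0 and are not
    integrable along phi, and the sign of a decides how the one-sided Bessel inequality can be
    applied. For the same reason the error in approximating g must itself be made of ramps: a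
    constant error, however small, has an infinite integral. Traces are divided by H_N rather than
    log N until the end, because H_N is exactly |v_t|^2. *)

Notation integrableR f :=
  (lebesgue_measure.-integrable [set: _] (EFin \o f)).
Notation intR f := (\int[lebesgue_measure]_(t in [set: _]) f t).

Section RealIntegrals.
Context {R : realType}.
Implicit Types (f h psi : R -> R).

Lemma eq_integrableR f h : f =1 h -> integrableR f -> integrableR h.
Proof. by move=> /funext ->. Qed.

Lemma eq_intR f h : f =1 h -> intR f = intR h.
Proof. by move=> /funext ->. Qed.

Lemma integrableR_measurable f : integrableR f -> measurable_fun setT f.
Proof. by move=> /integrableP[/measurable_EFinP]. Qed.

Lemma integrableRZ k f : integrableR f -> integrableR (fun t => k * f t).
Proof.
move=> fi; have := integrableZl measurableT k fi.
by apply: eq_integrable => // t _ /=.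
Qed.

Lemma integrableRD f h : integrableR f -> integrableR h ->
  integrableR (fun t => f t + h t).
Proof.
move=> fi hi; have := integrableD measurableT fi hi.
by apply: eq_integrable => // t _ /=.
Qed.

Lemma integrableRN f : integrableR f -> integrableR (fun t => - f t).
Proof.
move=> /(integrableRZ (-1)); apply: eq_integrableR => t.
by rewrite mulN1r.
Qed.

Lemma integrableRB f h : integrableR f -> integrableR h ->
  integrableR (fun t => f t - h t).
Proof. by move=> fi /integrableRN hi; exact: integrableRD. Qed.

Lemma integrableR0 : integrableR (fun _ : R => 0 : R).
Proof. exact: integrable0. Qed.

Lemma integrableR_sum (I : Type) (s : seq I) (F : I -> R -> R) :
  (forall i, integrableR (F i)) -> integrableR (fun t => \sum_(i <- s) F i t).
Proof.
move=> Fi; elim: s => [|i s IH].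
  by apply: eq_integrableR integrableR0 => t; rewrite big_nil.
by apply: eq_integrableR (integrableRD (Fi i) IH) => t; rewrite big_cons.
Qed.

Lemma le_integrableR f h : measurable_fun setT f ->
  (forall t, `|f t| <= h t) -> integrableR h -> integrableR f.
Proof.
move=> mf fh; apply: le_integrable => //; first exact/measurable_EFinP.
by move=> t _ /=; rewrite lee_fin (le_trans (fh t))// ler_norm.
Qed.

Lemma integrableRM f h (M : R) : integrableR f -> measurable_fun setT h ->
  (forall t, `|h t| <= M) -> integrableR (fun t => f t * h t).
Proof.
move=> fi mh hM; apply: (@le_integrableR _ (fun t => M * `|f t|)).
- by apply: measurable_funM => //; exact: integrableR_measurable.
- by move=> t; rewrite normrM mulrC ler_wpM2r.
- by apply: integrableRZ; exact: integrable_norm.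
Qed.

Lemma intRZ k f : integrableR f -> intR (fun t => k * f t) = k * intR f.
Proof. by move=> fi; rewrite RintegralZl. Qed.

Lemma intRD f h : integrableR f -> integrableR h ->
  intR (fun t => f t + h t) = intR f + intR h.
Proof. by move=> fi hi; rewrite RintegralD. Qed.

Lemma intRN f : intR (fun t => - f t) = - intR f.
Proof. exact: RintegralN_setT. Qed.

Lemma intRB f h : integrableR f -> integrableR h ->
  intR (fun t => f t - h t) = intR f - intR h.
Proof. by move=> fi hi; rewrite RintegralB. Qed.

Lemma intR0 : intR (fun _ : R => 0 : R) = 0.
Proof. by rewrite /Rintegral integral0. Qed.

Lemma intR_sum (I : Type) (s : seq I) (F : I -> R -> R) :
  (forall i, integrableR (F i)) ->
  intR (fun t => \sum_(i <- s) F i t) = \sum_(i <- s) intR (F i).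
Proof.
move=> Fi; elim: s => [|i s IH].
  by rewrite big_nil -[RHS]intR0; apply: eq_intR => t; rewrite big_nil.
rewrite big_cons -IH -intRD//; last exact: integrableR_sum.
by apply: eq_intR => t; rewrite big_cons.
Qed.

Lemma le_intR f h : integrableR f -> integrableR h ->
  (forall t, f t <= h t) -> intR f <= intR h.
Proof. by move=> fi hi fh; apply: le_Rintegral. Qed.

Lemma intR_ge0 f : (forall t, 0 <= f t) -> 0 <= intR f.
Proof. by move=> f0; apply: Rintegral_ge0. Qed.

Lemma intR_cvg (f_ : nat -> R -> R) f h :
  (forall n, measurable_fun setT (f_ n)) ->
  integrableR h -> (forall n t, `|f_ n t| <= h t) ->
  (forall t, f_ ^~ t @ \oo --> f t) ->
  (fun n => intR (f_ n)) @ \oo --> intR f.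
Proof.
move=> mf hi fh ff.
have mlim : measurable_fun setT f.
  by apply: (@measurable_fun_cvg _ _ _ _ f_) => // t _; exact: ff.
have fint : integrableR f.
  apply: le_integrableR hi => // t.
  have fnt : `|f_ n t| @[n --> \oo] --> `|f t| by apply: cvg_norm; exact: ff.
  rewrite -(cvg_lim _ fnt)//; apply: limr_le; first by apply/cvg_ex; exists `|f t|.
  by apply: nearW.
have mf' n : measurable_fun [set: R] (EFin \o f_ n) by exact/measurable_EFinP.
have mflim' : measurable_fun [set: R] (EFin \o f) by exact/measurable_EFinP.
have ff' : {ae lebesgue_measure, forall t : R, [set: R] t ->
    (EFin \o f_ n) t @[n --> \oo] --> (EFin \o f) t}.
  by apply: aeW => t _; apply: cvg_EFin; [exact: nearW | exact: ff].
have fh' : {ae lebesgue_measure, forall (t : R) n, [set: R] t ->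
    (`|(EFin \o f_ n) t| <= (EFin \o h) t)%E}.
  by apply: aeW => t n _ /=; rewrite lee_fin.
have [_ _] := @dominated_convergence _ _ R (@lebesgue_measure R) setT
  measurableT _ _ _ mf' mflim' ff' hi fh'.
rewrite -[X in _ --> X](fineK (integrable_fin_num measurableT fint)).
by move=> /fine_cvgP[].
Qed.

End RealIntegrals.

(** * Calculus rules for functions given by explicit formulas *)

Section PointwiseDerivatives.
Context {R : realType}.
Implicit Types (f g : R -> R) (x df dg k : R).

Lemma is_deriveD_fun f g x df dg : is_derive x 1 f df -> is_derive x 1 g dg ->
  is_derive x 1 (fun t => f t + g t) (df + dg).
Proof. by move=> hf hg; apply: (@is_derive_eq _ _ _ (f + g)). Qed.

Lemma is_deriveZ_fun k f x df : is_derive x 1 f df ->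
  is_derive x 1 (fun t => k * f t) (k * df).
Proof. by move=> hf; apply: (@is_derive_eq _ _ _ (k *: f)). Qed.

Lemma is_deriveM_fun f g x df dg : is_derive x 1 f df -> is_derive x 1 g dg ->
  is_derive x 1 (fun t => f t * g t) (f x * dg + g x * df).
Proof. by move=> hf hg; apply: (@is_derive_eq _ _ _ (f * g)). Qed.

Lemma is_derive_comp_fun f g x df dg : is_derive (g x) 1 f df ->
  is_derive x 1 g dg -> is_derive x 1 (fun t => f (g t)) (dg * df).
Proof. by move=> hf hg; rewrite mulrC; apply: (@is_derive_eq _ _ _ (f \o g)). Qed.

Lemma continuousD_fun f g : continuous f -> continuous g ->
  continuous (fun t => f t + g t).
Proof. by move=> cf cg t; apply: (@continuousD _ _ _ f g); [exact: cf|exact: cg]. Qed.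

Lemma continuousM_fun f g : continuous f -> continuous g ->
  continuous (fun t => f t * g t).
Proof. by move=> cf cg t; apply: (@continuousM _ _ f g); [exact: cf|exact: cg]. Qed.

Lemma continuousN_fun f : continuous f -> continuous (fun t => - f t).
Proof. by move=> cf t; apply: (@continuousN _ _ _ f); exact: cf. Qed.

Lemma continuous_comp_fun f g : continuous f -> continuous g ->
  continuous (fun t => f (g t)).
Proof. by move=> cf cg t; apply: (@continuous_comp _ _ _ g f); [exact: cg|exact: cf]. Qed.

Lemma continuous_cst_fun k : continuous (fun _ : R => k).
Proof. by move=> t; exact: cst_continuous. Qed.

Lemma continuous_id_fun : continuous (fun t : R => t).
Proof. by move=> t; exact: id. Qed.

End PointwiseDerivatives.

(** * Fourier transform of the exponential weight *)

Section ExponentialWeight.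
Context {R : realType}.
Implicit Types (e u t b c : R).

Definition expw e t : R := expR (- (e * `|t|)).

Lemma expw_ge0 e t : 0 <= expw e t. Proof. exact: expR_ge0. Qed.

Lemma expw_le1 e t : 0 <= e -> expw e t <= 1.
Proof. by move=> e0; rewrite expR_le1 oppr_le0 mulr_ge0. Qed.

Lemma continuous_expw e : continuous (expw e).
Proof.
move=> t; apply: (@continuous_comp _ _ _ (fun t => - (e * `|t|)) expR).
  apply: continuousN; apply: continuousM; first exact: cst_continuous.
  exact: norm_continuous.
exact: continuous_expR.
Qed.

Lemma ge0_integral_fold (f : R -> R) : (forall x, 0 <= f x) -> continuous f ->
  (\int[lebesgue_measure]_x (f x)%:E =
   \int[lebesgue_measure]_(x in `[0%R, +oo[) (f x + f (- x))%:E)%E.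
Proof.
move=> f0 cf.
have mf : measurable_fun [set: R] f by exact: continuous_measurable_fun.
have mpos : measurable [set x : R | 0 <= x]%R by rewrite -set_itvcy.
rewrite -(setUv [set x : R | 0 <= x]%R) ge0_integral_setU//= ; last 4 first.
  exact: measurableC.
  by apply/measurable_EFinP; rewrite setUv.
  by move=> x _; rewrite lee_fin.
  exact/disj_setPCl.
rewrite -set_itvcy// setCitvr.
rewrite integral_itv_bndo_bndc; last exact/measurable_EFinP/measurable_funTS.
rewrite -{2}oppr0 ge0_integration_by_substitutionNy//; last first.
  exact: continuous_subspaceT.
rewrite -ge0_integralD//.
- by move=> x _; apply: f0.
- exact/measurable_EFinP/measurable_funTS.
- by move=> x _; apply: f0.
- apply/measurable_EFinP/measurable_funTS.
  apply: continuous_measurable_fun => x; apply: continuous_comp.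
    exact: opp_continuous.
  exact: cf.
Qed.

(** The condition [|b| + |c| <= 1] makes the integrand nonnegative, so that the improper integral
    can be evaluated before integrability is known. The pairs (0, 0), (1, 0) and (0, 1) yield the
    mass, the cosine transform and the sine transform by subtraction. *)
Lemma integral_expw_trig e u b c : 0 < e -> `|b| + `|c| <= 1 ->
  (\int[lebesgue_measure]_t
     (expw e t * (1 + b * cos (t * u) + c * sin (t * u)))%:E =
   (2 / e + 2 * b * e / (e ^+ 2 + u ^+ 2))%:E)%E.
Proof.
move=> e0 bc.
have b1 : `|b| <= 1 by rewrite (le_trans _ bc)// lerDl.
have eu0 : e ^+ 2 + u ^+ 2 != 0.
  by rewrite gt_eqF// ltr_wpDr ?sqr_ge0// exprn_gt0.
have contu (h : R -> R) : continuous h -> continuous (fun t => h (t * u)).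
  move=> ch t; apply: (@continuous_comp _ _ _ (fun t => t * u) h).
    by apply: continuousM; [exact: id|exact: cst_continuous].
  exact: ch.
have cc : continuous (fun t => cos (t * u)) by apply: contu; exact: continuous_cos.
have cs : continuous (fun t => sin (t * u)) by apply: contu; exact: continuous_sin.
have trig_ge0 t : 0 <= 1 + b * cos (t * u) + c * sin (t * u).
  have : `|b * cos (t * u)| + `|c * sin (t * u)| <= 1.
    apply: le_trans bc; rewrite !normrM.
    by apply: lerD; rewrite ler_piMr// ?cos_max ?sin_max.
  move: (ler_norm (- (b * cos (t * u)))) (ler_norm (- (c * sin (t * u)))).
  rewrite !normrN; lra.
rewrite ge0_integral_fold; last 2 first.
- by move=> t; rewrite mulr_ge0 ?expw_ge0.
- move=> t; apply: continuousM; first exact: continuous_expw.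
  apply: continuousD; first apply: continuousD; first exact: cst_continuous.
    by apply: continuousM; [exact: cst_continuous|exact: cc].
  by apply: continuousM; [exact: cst_continuous|exact: cs].
(* Folding the line at 0 cancels the sine and doubles the rest: [f] is the folded integrand, [F] its
   primitive that vanishes at infinity, and the integral is [- F 0]. *)
pose K1 := - (2 / e); pose K2 := 2 * b / (e ^+ 2 + u ^+ 2).
pose f t := expR (- (e * t)) * (2 + 2 * b * cos (t * u)).
pose F t := expR (- (e * t)) * (K1 + K2 * (u * sin (t * u) - e * cos (t * u))).
have cf : continuous f.
  rewrite /f => t. apply: (@continuousM R R (fun t => expR (- (e * t)))).
    apply: (@continuous_comp _ _ _ (fun t => - (e * t)) expR).
      by apply: continuousN; apply: continuousM; [exact: cst_continuous|exact: id].
    exact: continuous_expR.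
  apply: continuousD; first exact: cst_continuous.
  by apply: continuousM; [exact: cst_continuous|exact: cc].
have dF t : is_derive t 1 F (f t).
  have de : is_derive t 1 (fun t => expR (- (e * t))) (- e * expR (- (e * t))).
    apply: (is_derive_comp_fun (f := expR) (g := fun t => - (e * t))).
    under eq_fun do rewrite -mulNr.
    by rewrite -[X in is_derive _ _ _ X]mulr1; apply: is_deriveZ_fun.
  have dlin : is_derive t 1 (fun t => t * u) u.
    under eq_fun do rewrite mulrC.
    by rewrite -[X in is_derive _ _ _ X]mulr1; apply: is_deriveZ_fun.
  have ds := @is_derive_comp_fun _ _ (fun x => x * u) t _ _ (is_derive_sin (t * u)) dlin.
  have dc := @is_derive_comp_fun _ _ (fun x => x * u) t _ _ (is_derive_cos (t * u)) dlin.
  have d3 := is_deriveD_fun (is_deriveZ_fun u ds) (is_deriveZ_fun (- e) dc).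
  have d4 := is_deriveM_fun de
    (is_deriveD_fun (is_derive_cst K1 t 1) (is_deriveZ_fun K2 d3)).
  have -> : F = fun t => expR (- (e * t)) *
      (cst K1 t + K2 * (u * sin (t * u) + - e * cos (t * u))).
    by apply/funext => x; rewrite /F mulNr.
  apply: (@is_derive_eq _ _ _ _ _ _ _ _ d4).
  rewrite /f /K1 /K2 /=; field.
  by rewrite eu0 gt_eqF.
transitivity (\int[lebesgue_measure]_(x in `[0%R, +oo[) (f x)%:E)%E.
  apply: eq_integral => t; rewrite inE/= in_itv/= andbT => t0.
  congr EFin; rewrite /expw normrN ger0_norm// /f !mulNr cosN sinN.
  by ring.
rewrite (@ge0_continuous_FTC2y _ f F 0 0).
- rewrite /F !mul0r sin0 cos0 mulr0 oppr0 expR0 -EFinB /K1 /K2; congr EFin.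
  by ring.
- move=> t _; rewrite mulr_ge0 ?expR_ge0//.
  have : `|b * cos (t * u)| <= 1 by rewrite normrM mulr_ile1// cos_max.
  by move: (ler_norm (- (b * cos (t * u)))); rewrite normrN; lra.
- exact: continuous_subspaceT.
- have cexp : expR (- (e * t)) @[t --> +oo] --> 0.
    have := cvg_comp (fun t => e * t) (fun t => expR (- t)) _ (@cvgr_expR R).
    apply; exact: gt0_cvgMry.
  pose M := `|K1| + `|K2| * (`|u| + e).
  have cM : expR (- (e * t)) * M @[t --> +oo] --> 0.
    by rewrite -[X in _ --> X](mul0r M); apply: cvgM => //; exact: cvg_cst.
  apply/norm_cvg0P; apply: (squeeze_cvgr _ (cvg_cst 0) cM).
  apply: nearW => t; rewrite normr_ge0/= normrM ger0_norm ?expR_ge0//.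
  rewrite ler_wpM2l ?expR_ge0// (le_trans (ler_normD _ _))// lerD2l normrM.
  rewrite ler_wpM2l// (le_trans (ler_normB _ _))// !normrM.
  by apply: lerD; [rewrite ler_piMr ?sin_max//|rewrite (gtr0_norm e0) ler_piMr ?cos_max// ltW].
- by move=> t _; case: (dF t).
- apply: cvg_at_right_filter; apply: differentiable_continuous.
  by apply/derivable1_diffP; case: (dF 0).
- by move=> t _; rewrite derive1E; case: (dF t).
Unshelve. all: by end_near. Qed.

Lemma integrable_expw e : 0 < e -> integrableR (expw e).
Proof.
move=> e0; apply/integrableP; split.
  apply/measurable_EFinP; apply: continuous_measurable_fun; exact: continuous_expw.
have b0 : `|0 : R| + `|0 : R| <= 1 by rewrite normr0 addr0.
have := integral_expw_trig 0 e0 b0.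
rewrite (_ : (fun t => _) = (fun t => `|(EFin \o expw e) t|)%E).
  by move=> ->; exact: ltry.
apply/funext => t /=; rewrite ger0_norm ?expw_ge0//.
by rewrite !mul0r !addr0 mulr1.
Qed.

Lemma measurable_expw e : measurable_fun [set: R] (expw e).
Proof. by apply: continuous_measurable_fun; exact: continuous_expw. Qed.

Lemma measurable_cosM u : measurable_fun [set: R] (fun t => cos (t * u)).
Proof.
apply: continuous_measurable_fun; apply: (continuous_comp_fun (@continuous_cos R)).
by apply: continuousM_fun; [exact: continuous_id_fun|exact: continuous_cst_fun].
Qed.

Lemma measurable_sinM u : measurable_fun [set: R] (fun t => sin (t * u)).
Proof.
apply: continuous_measurable_fun; apply: (continuous_comp_fun (@continuous_sin R)).
by apply: continuousM_fun; [exact: continuous_id_fun|exact: continuous_cst_fun].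
Qed.

Lemma intR_expw e : 0 < e -> intR (expw e) = 2 / e.
Proof.
move=> e0; have b0 : `|0 : R| + `|0 : R| <= 1 by rewrite normr0 addr0.
have := integral_expw_trig 0 e0 b0.
rewrite mulr0 !mul0r addr0 => /(congr1 fine)/= <-.
by apply: eq_intR => t; rewrite !mul0r !addr0 mulr1.
Qed.

Lemma intR_expw_cos e u : 0 < e ->
  intR (fun t => expw e t * cos (t * u)) = 2 * e / (e ^+ 2 + u ^+ 2).
Proof.
move=> e0; have b1 : `|1 : R| + `|0 : R| <= 1 by rewrite normr0 addr0 normr1.
have := integral_expw_trig u e0 b1 => /(congr1 fine)/=.
rewrite mulr1 => H; apply: (addrI (2 / e)); rewrite -H -{1}intR_expw// -intRD.
- by apply: eq_intR => t; rewrite mul0r mul1r addr0 mulrDr mulr1.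
- exact: integrable_expw.
- apply: (integrableRM (integrable_expw e0) (measurable_cosM u)) => t.
  exact: cos_max.
Qed.

Lemma intR_expw_sin e u : 0 < e -> intR (fun t => expw e t * sin (t * u)) = 0.
Proof.
move=> e0; have b1 : `|0 : R| + `|1 : R| <= 1 by rewrite normr0 add0r normr1.
have := integral_expw_trig u e0 b1 => /(congr1 fine)/=.
rewrite mulr0 !mul0r addr0 => H; apply: (addrI (2 / e)).
rewrite addr0 -[RHS]H -{1}intR_expw// -intRD.
- by apply: eq_intR => t; rewrite mul0r mul1r addr0 mulrDr mulr1.
- exact: integrable_expw.
- apply: (integrableRM (integrable_expw e0) (measurable_sinM u)) => t.
  exact: sin_max.
Qed.

End ExponentialWeight.

(** * The Poisson kernel and harmonic sums *)

Section PoissonKernel.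
Context {R : realType}.
Implicit Types (e u x y : R).

(** The Fourier transform of [expw e] in the normalization of [fourier]. *)
Definition poisson e u : R := e / (pi * (e ^+ 2 + u ^+ 2)).

Definition poisson_primitive e u : R := atan (u / e) / pi.

Lemma poisson_ge0 e u : 0 < e -> 0 <= poisson e u.
Proof.
by move=> e0; rewrite divr_ge0 ?(ltW e0)// mulr_ge0 ?pi_ge0// addr_ge0 ?sqr_ge0.
Qed.

Lemma poissonN e u : poisson e (- u) = poisson e u.
Proof. by rewrite /poisson sqrrN. Qed.

Lemma le_poisson e x y : 0 < e -> 0 <= x -> x <= y -> poisson e y <= poisson e x.
Proof.
move=> e0 x0 xy; rewrite /poisson ler_pM2l// lef_pV2 ?posrE.
- rewrite ler_pM2l ?pi_gt0// lerD2l lerXn2r// nnegrE//; lra.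
- by rewrite mulr_gt0 ?pi_gt0// ltr_wpDr ?sqr_ge0// exprn_gt0.
- by rewrite mulr_gt0 ?pi_gt0// ltr_wpDr ?sqr_ge0// exprn_gt0.
Qed.

Lemma is_derive_poisson_primitive e u : 0 < e ->
  is_derive u 1 (poisson_primitive e) (poisson e u).
Proof.
move=> e0.
have dlin : is_derive u 1 (fun t => t / e) e^-1.
  under eq_fun do rewrite mulrC.
  by rewrite -[X in is_derive _ _ _ X]mulr1; apply: is_deriveZ_fun.
have d := is_deriveZ_fun pi^-1
  (@is_derive_comp_fun _ _ (fun t => t / e) u _ _ (is_derive1_atan (u / e)) dlin).
rewrite /poisson_primitive; under eq_fun do rewrite mulrC.
apply: (@is_derive_eq _ _ _ _ _ _ _ _ d).
have eu0 : e ^+ 2 + u ^+ 2 != 0.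
  by rewrite gt_eqF// ltr_wpDr ?sqr_ge0// exprn_gt0.
have p0 : (pi : R) != 0 by rewrite gt_eqF ?pi_gt0.
rewrite /poisson; move: (pi : R) p0 => p p0; field.
by rewrite p0 eu0 gt_eqF.
Qed.

(** The kernel decreases on the positive half-line, so its mean over [x, y], attained by the mean
    value theorem, lies between its end values. All comparisons of sums with integrals below rest on
    this. *)
Lemma poisson_primitive_bounds e x y : 0 < e -> 0 <= x -> x <= y ->
  poisson e y * (y - x) <= poisson_primitive e y - poisson_primitive e x
  <= poisson e x * (y - x).
Proof.
move=> e0 x0; rewrite le_eqVlt => /predU1P[<-|xy].
  by rewrite !subrr !mulr0 lexx.
have [||z] := @MVT _ (poisson_primitive e) (poisson e) x y xy.
- by move=> z _; exact: is_derive_poisson_primitive.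
- apply: derivable_within_continuous => z _.
  by case: (is_derive_poisson_primitive z e0).
rewrite in_itv/= => /andP[xz zy] ->.
by rewrite !ler_pM2r ?subr_gt0// !le_poisson//; lra.
Qed.

Lemma poisson_primitive_le e u : poisson_primitive e u <= 2^-1.
Proof.
rewrite /poisson_primitive ler_pdivrMr ?pi_gt0// [leRHS]mulrC.
by apply: ltW; exact: atan_ltpi2.
Qed.

Lemma poisson_primitive0 e : poisson_primitive e 0 = 0.
Proof. by rewrite /poisson_primitive mul0r atan0 mul0r. Qed.

Lemma poisson_primitive_ge0 e u : 0 < e -> 0 <= u -> 0 <= poisson_primitive e u.
Proof.
move=> e0 u0; have /andP[+ _] := poisson_primitive_bounds e0 (lexx 0) u0.
rewrite poisson_primitive0 !subr0; apply: le_trans.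
by rewrite mulr_ge0 ?poisson_ge0.
Qed.

Lemma poisson_primitive_cvg e (d : R) : 0 < e -> 0 < d ->
  exists2 X : R, 0 <= X & forall u, X <= u -> 1 - 2 * poisson_primitive e u <= d.
Proof.
move=> e0 d0.
have h : poisson_primitive e u @[u --> +oo] --> (2^-1 : R).
  have -> : 2^-1 = pi / 2 / pi :> R by rewrite mulrAC divff ?mul1r// gt_eqF ?pi_gt0.
  apply: cvgM; last exact: cvg_cst.
  apply: (cvg_comp (fun u => u / e) atan); last exact: cvgy_atan.
  by apply: gt0_cvgMly; rewrite ?invr_gt0//; exact: cvg_id.
have d20 : 0 < d / 2 by rewrite divr_gt0.
have /cvgrPdist_le /(_ _ d20) [X [Xr XP]] := h.
exists (Num.max 0 (X + 1)); first by rewrite le_max lexx.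
move=> u; rewrite ge_max => /andP[u0 Xu].
have := XP u ltac:(lra) => /(le_trans (ler_norm _)); lra.
Qed.

End PoissonKernel.

(** * Harmonic sums of the Poisson kernel as Riemann sums *)

Section HarmonicSums.
Context {R : realType}.
Implicit Types (e X : R) (i j N : nat).

(* Indices start at 0: the paper's index is [i.+1]. *)
Definition logS i : R := ln i.+1%:R.

Definition harm N : R := \sum_(0 <= i < N) i.+1%:R^-1.

(** The grid [logS] has steps comparable to 1/n, so a sum weighted by 1/n is a Riemann sum in log
    n. *)
Lemma logS_step i : i.+2%:R^-1 <= logS i.+1 - logS i <= i.+1%:R^-1.
Proof.
have i1 : (0 : R) < i.+1%:R by rewrite ltr0n.
have i2 : (0 : R) < i.+2%:R by rewrite ltr0n.
have E : i.+2%:R = 1 + i.+1%:R :> R by rewrite -addn1 natrD addrC.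
have v1 : (0 : R) < i.+1%:R^-1 by rewrite invr_gt0.
have v2 : i.+2%:R^-1 < 1 :> R by rewrite invf_lt1// ltr1n.
apply/andP; split.
  rewrite -[leRHS]opprB lerNr -ln_div ?posrE//.
  have -> : i.+1%:R / i.+2%:R = 1 + - i.+2%:R^-1 :> R.
    by move: i2; rewrite E => i2; field; rewrite gt_eqF.
  by apply: le_ln1Dx; rewrite ltrN2.
rewrite -ln_div ?posrE//.
have -> : i.+2%:R / i.+1%:R = 1 + i.+1%:R^-1 :> R.
  by rewrite E; field; rewrite gt_eqF.
by apply: le_ln1Dx; rewrite (lt_trans _ v1)// ltrN10.
Qed.

Lemma le_logS i j : (i <= j)%N -> logS i <= logS j.
Proof. by move=> ij; rewrite ler_ln ?posrE ?ltr0n// ler_nat ltnS. Qed.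

Lemma logS0 : logS 0 = 0. Proof. exact: ln1. Qed.

Lemma harm_ge N : logS N <= harm N.
Proof.
elim: N => [|N IH]; first by rewrite logS0 /harm big_geq.
rewrite /harm big_nat_recr//= -/(harm N).
have /andP[_] := logS_step N; move: (N.+1%:R^-1) => v s; lra.
Qed.

Lemma harm_le N : harm N.+1 <= 1 + logS N.
Proof.
elim: N => [|N IH]; first by rewrite logS0 /harm big_nat1 invr1; lra.
rewrite /harm big_nat_recr//= -/(harm N.+1).
have /andP[+ _] := logS_step N; move: (N.+2%:R^-1) => v s; lra.
Qed.

Lemma harm_ge0 N : 0 <= harm N.
Proof. by apply: sumr_ge0 => i _; rewrite invr_ge0. Qed.

Lemma sum_invsq_le N : \sum_(0 <= i < N) (i.+1%:R ^+ 2)^-1 <= 2 :> R.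
Proof.
case: N => [|N]; first by rewrite big_geq.
suff : \sum_(0 <= i < N.+1) (i.+1%:R ^+ 2)^-1 <= 2 - N.+1%:R^-1 :> R.
  by move/le_trans; apply; rewrite lerBlDr lerDl invr_ge0.
elim: N => [|N IH]; first by rewrite big_nat1 expr1n invr1; lra.
rewrite big_nat_recr//=.
have n1 : (0 : R) < N.+1%:R by rewrite ltr0n.
have E : N.+2%:R = 1 + N.+1%:R :> R by rewrite -addn1 natrD addrC.
suff : (N.+2%:R ^+ 2)^-1 <= N.+1%:R^-1 - N.+2%:R^-1 :> R.
  move: IH; move: (N.+1%:R^-1 : R) (N.+2%:R^-1 : R) ((N.+2%:R ^+ 2)^-1 : R).
  by move=> v w z IH h; lra.
have -> : N.+1%:R^-1 - N.+2%:R^-1 = (N.+1%:R * N.+2%:R)^-1 :> R.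
  by rewrite E; field; rewrite !gt_eqF//; lra.
rewrite lef_pV2 ?posrE ?mulr_gt0 ?exprn_gt0 ?ltr0n//.
by rewrite expr2 ler_pM2r ?ltr0n// ler_nat.
Qed.

(** A lower Riemann sum to the right of [logS i]: the kernel is taken at the far end [logS j] of
    each cell, whose length is at least [j.+1%:R^-1]. Half of the mass one lies on that side. *)
Lemma sum_poisson_above e i N : 0 < e ->
  \sum_(i.+1 <= j < N) poisson e (logS j - logS i) / j.+1%:R <= 2^-1.
Proof.
move=> e0; have [iN|Ni] := leqP i.+1 N; last first.
  by rewrite big_geq ?invr_ge0// ltnW.
rewrite big_add1.
apply: (@le_trans _ _ (\sum_(i <= j < N.-1)
  (poisson_primitive e (logS j.+1 - logS i)
   - poisson_primitive e (logS j - logS i)))).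
  apply: ler_sum_nat => j /andP[ij _].
  have /andP[+ _] := logS_step j; move: (j.+2%:R^-1) => v s.
  have h := le_logS ij; have h2 := le_logS (leqnSn j).
  have xy : logS j - logS i <= logS j.+1 - logS i by lra.
  have x0 : 0 <= logS j - logS i by lra.
  have /andP[+ _] := poisson_primitive_bounds e0 x0 xy.
  by apply: le_trans; rewrite ler_wpM2l ?poisson_ge0//; lra.
rewrite (telescope_sumr (fun j => poisson_primitive e (logS j - logS i))).
  by rewrite subrr poisson_primitive0 subr0 poisson_primitive_le.
by rewrite -ltnS prednK// (leq_trans _ iN).
Qed.

(** To the left of [logS j] the far end of a cell is its smaller index [i], and the cell is only
    guaranteed the length [i.+2%:R^-1]. This shift by one causes the asymmetry of the Schur weights
    [w]. *)
Lemma sum_poisson_below e j : 0 < e ->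
  \sum_(0 <= i < j) poisson e (logS j - logS i) / i.+2%:R <= 2^-1.
Proof.
move=> e0.
apply: (@le_trans _ _ (\sum_(0 <= i < j)
  ((- poisson_primitive e (logS j - logS i.+1))
   - (- poisson_primitive e (logS j - logS i))))).
  apply: ler_sum_nat => i /andP[_ ij].
  have /andP[+ _] := logS_step i; move: (i.+2%:R^-1) => v s.
  have h := le_logS ij; have h2 := le_logS (leqnSn i).
  have xy : logS j - logS i.+1 <= logS j - logS i by lra.
  have x0 : 0 <= logS j - logS i.+1 by lra.
  have /andP[+ _] := poisson_primitive_bounds e0 x0 xy.
  rewrite opprK [leRHS]addrC; apply: le_trans.
  by rewrite ler_wpM2l ?poisson_ge0//; lra.
rewrite (telescope_sumr (fun i => - poisson_primitive e (logS j - logS i)))//.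
by rewrite subrr poisson_primitive0 oppr0 sub0r opprK poisson_primitive_le.
Qed.

(** Here the kernel is taken at the near end of each cell, so that the diagonal term [j = i] is
    included, and the step is bounded from above. *)
Lemma sum_poisson_lower e i N : 0 < e -> (i <= N)%N ->
  poisson_primitive e (logS N - logS i) <=
  \sum_(i <= j < N) poisson e (logS j - logS i) / j.+1%:R.
Proof.
move=> e0 iN.
apply: (@le_trans _ _ (\sum_(i <= j < N)
  (poisson_primitive e (logS j.+1 - logS i)
   - poisson_primitive e (logS j - logS i)))).
  rewrite (telescope_sumr (fun j => poisson_primitive e (logS j - logS i)))//.
  by rewrite subrr poisson_primitive0 subr0.
apply: ler_sum_nat => j /andP[ij _].
have /andP[_] := logS_step j; move: (j.+1%:R^-1) => v s.
have h := le_logS ij; have h2 := le_logS (leqnSn j).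
have xy : logS j - logS i <= logS j.+1 - logS i by lra.
have x0 : 0 <= logS j - logS i by lra.
have /andP[_ +] := poisson_primitive_bounds e0 x0 xy.
move=> /le_trans; apply.
by rewrite ler_wpM2l ?poisson_ge0//; lra.
Qed.

(** For indices close to [N] on the logarithmic scale the kernel sees too little of its right half.
    Their total harmonic weight is bounded independently of [N]. *)
Lemma sum_inv_near X N : 0 <= X ->
  \sum_(0 <= i < N) (if logS N - logS i < X then i.+1%:R^-1 else 0) <= 2 * X.
Proof.
move=> X0.
(* Increments of twice the truncated distance to [logS N]: with the factor 2, a cell of length at
   least 1/(i + 2) pays for 1/(i + 1). *)
pose F i := - (2 * Num.min X (logS N - logS i)).
apply: (@le_trans _ _ (\sum_(0 <= i < N) (F i.+1 - F i))).
  apply: ler_sum_nat => i /andP[_ iN].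
  have h2 := le_logS (leqnSn i); have /andP[s _] := logS_step i.
  have s2 : i.+1%:R^-1 <= 2 * i.+2%:R^-1 :> R.
    rewrite ler_pdivlMr ?ltr0n// mulrC ler_pdivrMr ?ltr0n//.
    by rewrite -natrM ler_nat mul2n -addnn addSn ltnS leq_addl.
  move: (i.+1%:R^-1) (i.+2%:R^-1) s s2 => v w s s2.
  rewrite /F; case: ltP => hX; last first.
    have := @ge_min _ _ X X (logS N - logS i.+1); rewrite lexx/=.
    by lra.
  by rewrite (min_idPr _); lra.
rewrite telescope_sumr// /F subrr (min_idPr X0) mulr0 oppr0 sub0r opprK.
by rewrite ler_wpM2l// ge_min lexx.
Qed.

End HarmonicSums.

(** * Schur's test and asymptotics of the Poisson form *)

Section PoissonForm.
Context {R : realType}.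
Implicit Types (e C : R) (i j N : nat) (x : nat -> R).

(* Damps the first few indices, for which the Poisson sums overshoot. *)
Definition damp C i : R := i.+1%:R / (i.+1%:R + C).

(** The damped Poisson form at v_0, whose entries n^(-1/2) turn the square root of n m in the matrix
    into n m. *)
Definition poisson_form e C N : R :=
  \sum_(0 <= i < N) \sum_(0 <= j < N)
    damp C i * damp C j * poisson e (logS i - logS j) / (i.+1%:R * j.+1%:R).

Let S_gt0 i : 0 < i.+1%:R :> R. Proof. by rewrite ltr0n. Qed.

Lemma damp_ge0 C i : 0 <= C -> 0 <= damp C i.
Proof. by move=> C0; rewrite divr_ge0// addr_ge0. Qed.

Lemma damp_le1 C i : 0 <= C -> damp C i <= 1.
Proof.
by move=> C0; rewrite ler_pdivrMr ?mul1r ?lerDl// ltr_wpDr.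
Qed.

Lemma le_damp C i j : 0 <= C -> (i <= j)%N -> damp C i <= damp C j.
Proof.
move=> C0 ij; have ij' : i.+1%:R <= j.+1%:R :> R by rewrite ler_nat ltnS.
rewrite /damp ler_pdivrMr ?ltr_wpDr// mulrAC ler_pdivlMr ?ltr_wpDr//.
move: (i.+1%:R : R) (j.+1%:R : R) ij' => a b ab.
rewrite -subr_ge0 (_ : _ - _ = (b - a) * C); last by ring.
by rewrite mulr_ge0// subr_ge0.
Qed.

Lemma damp_ge C i : 0 <= C -> 1 - C / i.+1%:R <= damp C i.
Proof.
move=> C0; rewrite /damp ler_pdivlMr ?ltr_wpDr//.
have n0 := S_gt0 i; move: (i.+1%:R : R) n0 => n n0.
have -> : (1 - C / n) * (n + C) = n - C ^+ 2 / n by field; rewrite gt_eqF.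
by rewrite gerBl divr_ge0 ?sqr_ge0// ltW.
Qed.

(* Weights of the Schur test: [w i j * w j i = 1 / (i.+1 * j.+1)]. *)
Let w i j : R := if (i < j)%N then i.+2%:R / (i.+1%:R * j.+1%:R)
  else if (j < i)%N then j.+2%:R^-1 else i.+1%:R^-1.

Let w_ge0 i j : 0 <= w i j.
Proof. by rewrite /w; do 2?case: ifP => _; rewrite ?divr_ge0 ?invr_ge0 ?mulr_ge0. Qed.

Let wM i j : w i j * w j i = (i.+1%:R * j.+1%:R)^-1.
Proof.
have nz k : k.+1%:R != 0 :> R by rewrite pnatr_eq0.
rewrite /w; case: ltngtP => [ij|ji|->].
- by rewrite mulrAC divff ?mul1r.
- by rewrite mulrA mulVf ?mul1r// mulrC.
- by rewrite invfM.
Qed.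

(** With n = i + 1, the left, diagonal and right parts of the row contribute at most 1/2, P(0)/n and
    (1 + 1/n)/2, in total 1 + (P(0) + 1/2)/n. The factor [damp C i] = n/(n + C) brings this below 1
    as soon as C >= P(0) + 1/2. *)
Let row_sum e C i N : 0 < e -> poisson e 0 + 2^-1 <= C -> (i < N)%N ->
  \sum_(0 <= j < N) damp C i * damp C j * poisson e (logS i - logS j) * w i j <= 1.
Proof.
move=> e0 PC iN.
have P0 : 0 <= poisson e 0 by rewrite poisson_ge0.
have C0 : 0 <= C by lra.
have r0 := damp_ge0 i C0.
have Pge0 u := poisson_ge0 u e0.
apply: (@le_trans _ _ (damp C i *
   \sum_(0 <= j < N) poisson e (logS i - logS j) * w i j)).
  rewrite mulr_sumr; apply: ler_sum_nat => j _.
  rewrite -mulrA -mulrA ler_wpM2l// ler_piMl ?damp_le1//.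
  by rewrite mulr_ge0.
rewrite (big_cat_nat (n := i))//=; last exact: ltnW.
rewrite [X in _ + X]big_ltn// /w ltnn subrr.
have h1 : \sum_(0 <= j < i) poisson e (logS i - logS j) *
    (if (i < j)%N then i.+2%:R / (i.+1%:R * j.+1%:R)
     else if (j < i)%N then j.+2%:R^-1 else i.+1%:R^-1) <= 2^-1.
  apply: le_trans (sum_poisson_below i e0); apply: ler_sum_nat => j /andP[_ ji].
  by rewrite ltnNge (ltnW ji)/= ji.
have h2 : \sum_(i.+1 <= j < N) poisson e (logS i - logS j) *
    (if (i < j)%N then i.+2%:R / (i.+1%:R * j.+1%:R)
     else if (j < i)%N then j.+2%:R^-1 else i.+1%:R^-1)
     <= i.+2%:R / i.+1%:R * 2^-1.
  apply: le_trans (ler_wpM2l _ (sum_poisson_above i N e0)); last first.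
    by rewrite divr_ge0.
  rewrite mulr_sumr; apply: ler_sum_nat => j /andP[-> _].
  rewrite -(poissonN e (logS j - logS i)) opprB le_eqVlt; apply/orP; left.
  apply/eqP; move: (poisson _ _) (i.+2%:R : R) => P v.
  have := S_gt0 i; have := S_gt0 j; move: (i.+1%:R : R) (j.+1%:R : R) => n m n0 m0.
  by field; rewrite !gt_eqF.
apply: (@le_trans _ _ (damp C i *
    (2^-1 + (poisson e 0 / i.+1%:R + i.+2%:R / i.+1%:R * 2^-1)))).
  by rewrite ler_wpM2l//; do 2 apply: lerD => //.
have E : i.+2%:R = 1 + i.+1%:R :> R by rewrite -addn1 natrD addrC.
rewrite E /damp; have n0 := S_gt0 i; move: (i.+1%:R : R) n0 => n n0.
rewrite mulrAC ler_pdivrMr ?mul1r; last by lra.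
have -> : n * (2^-1 + (poisson e 0 / n + (1 + n) / n / 2)) =
    n + (poisson e 0 + 2^-1).
  by move: (poisson e 0) => P; field; rewrite gt_eqF.
by rewrite lerD2l.
Qed.

Lemma poisson_schur e C N x : 0 < e -> poisson e 0 + 2^-1 <= C ->
  (forall i, 0 <= x i) ->
  \sum_(0 <= i < N) \sum_(0 <= j < N)
    damp C i * damp C j * poisson e (logS i - logS j)
      * ((Num.sqrt (i.+1%:R * j.+1%:R))^-1 * (x i * x j))
  <= \sum_(0 <= i < N) x i ^+ 2.
Proof.
move=> e0 PC x0.
have P0 : 0 <= poisson e 0 by rewrite poisson_ge0.
have C0 : 0 <= C by lra.
pose a i j := damp C i * damp C j * poisson e (logS i - logS j).
have a_sym i j : a i j = a j i by rewrite /a -poissonN opprB [damp C i * _]mulrC.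
have a_ge0 i j : 0 <= a i j by rewrite mulr_ge0 ?poisson_ge0// mulr_ge0 ?damp_ge0.
(* Weighted arithmetic-geometric mean inequality: by [wM] the geometric mean of [w i j] and [w j i]
   is the square-root factor of the matrix. As [a] is symmetric, both halves become row sums. *)
have amgm i j : (Num.sqrt (i.+1%:R * j.+1%:R))^-1 * (x i * x j)
    <= 2^-1 * (w i j * x i ^+ 2) + 2^-1 * (w j i * x j ^+ 2).
  rewrite -sqrtrV ?mulr_ge0// -wM sqrtrM//.
  rewrite -[X in _ <= _ * (X * _) + _]sqr_sqrtr//.
  rewrite -[X in _ <= _ + _ * (X * _)]sqr_sqrtr//.
  move: (Num.sqrt _ : R) (Num.sqrt _ : R) => t s.
  have h := sqr_ge0 (s * x i - t * x j); lra.
apply: (@le_trans _ _ (\sum_(0 <= i < N) \sum_(0 <= j < N)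
   (2^-1 * (a i j * w i j * x i ^+ 2) + 2^-1 * (a j i * w j i * x j ^+ 2)))).
  apply: ler_sum_nat => i _; apply: ler_sum_nat => j _; rewrite -/(a i j).
  rewrite (a_sym j i); have := ler_wpM2l (a_ge0 i j) (amgm i j); lra.
under eq_bigr do rewrite big_split/=.
rewrite big_split/= [X in _ + X]exchange_big/= -big_split/=.
apply: ler_sum_nat => i /andP[_ iN].
rewrite -big_split/=.
have half : 2^-1 + 2^-1 = 1 :> R by lra.
under eq_bigr do rewrite -mulrDl half mul1r.
by rewrite -mulr_suml ler_piMl ?sqr_ge0// row_sum.
Qed.

Let sum_triangle (t : nat -> nat -> R) N :
  \sum_(0 <= i < N) \sum_(0 <= j < i) t j i =
  \sum_(0 <= i < N) \sum_(i.+1 <= j < N) t i j.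
Proof.
elim: N => [|N IH]; first by rewrite !big_geq.
rewrite big_nat_recr//= IH [RHS]big_nat_recr//= [X in _ = _ + X]big_geq// addr0.
rewrite -big_split/= [LHS]big_nat_cond [RHS]big_nat_cond.
apply: eq_bigr => i /andP[/andP[_ iN] _].
by rewrite big_nat_recr.
Qed.

(** By symmetry the form is twice its upper triangle minus the diagonal. In each row the upper
    triangle carries nearly half the mass of the kernel unless the row is close to N, while damping
    and diagonal cost O(1/n^2). *)
Lemma poisson_form_lower e C (d : R) : 0 < e -> 0 <= C -> 0 < d ->
  exists K : R, forall N, harm N - poisson_form e C N <= d * harm N + K.
Proof.
move=> e0 C0 d0.
have [X X0 hX] := poisson_primitive_cvg e0 d0.
(* [2 * X] pays for the indices within [X] of [logS N], the rest for damping and diagonal through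
   [sum_invsq_le]. *)
exists (2 * X + 4 * C + 2 * poisson e 0) => N.
pose t i j := damp C i * damp C j * poisson e (logS i - logS j)
  / (i.+1%:R * j.+1%:R).
have tC i j : t i j = t j i.
  by rewrite /t -poissonN opprB [damp C i * _]mulrC [_%:R * _]mulrC.
have t_ge0 i j : 0 <= t i j.
  by rewrite divr_ge0// mulr_ge0 ?poisson_ge0// mulr_ge0 ?damp_ge0.
have P0 : 0 <= poisson e 0 by rewrite poisson_ge0.
have split_form : poisson_form e C N =
    2 * (\sum_(0 <= i < N) \sum_(i <= j < N) t i j) - \sum_(0 <= i < N) t i i.
  rewrite /poisson_form mulr2n mulrDl mul1r -addrA.
  under [X in X = _]eq_big_nat => i /andP[_ iN].
    rewrite -/(t i) (big_cat_nat (n := i)) ?(ltnW iN)//=.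
    under eq_bigr do rewrite -/(t i _) tC.
    over.
  rewrite big_split/= addrC; congr (_ + _).
  rewrite sum_triangle -sumrB [LHS]big_nat_cond [RHS]big_nat_cond.
  apply: eq_bigr => i /andP[/andP[_ iN] _].
  by rewrite [in RHS]big_ltn// addrAC subrr add0r.
have low i : (i < N)%N -> damp C i ^+ 2 / i.+1%:R
    * poisson_primitive e (logS N - logS i) <= \sum_(i <= j < N) t i j.
  move=> iN; apply: le_trans (ler_wpM2l _ (sum_poisson_lower e0 (ltnW iN))) _.
    by rewrite divr_ge0 ?sqr_ge0.
  rewrite mulr_sumr; apply: ler_sum_nat => j /andP[ij _].
  rewrite /t -(poissonN e (logS i - logS j)) opprB.
  rewrite [leLHS](_ : _ = damp C i * damp C i * poisson e (logS j - logS i)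
    / (i.+1%:R * j.+1%:R)).
    rewrite ler_wpM2r ?invr_ge0 ?mulr_ge0// ler_wpM2r ?poisson_ge0//.
    by rewrite ler_wpM2l ?damp_ge0 ?le_damp.
  move: (poisson _ _) (damp _ _) => P r.
  have := S_gt0 i; have := S_gt0 j; move: (i.+1%:R : R) (j.+1%:R : R) => n m n0 m0.
  by field; rewrite !gt_eqF.
apply: (@le_trans _ _ (\sum_(0 <= i < N) (i.+1%:R^-1 * d
   + (if logS N - logS i < X then i.+1%:R^-1 else 0)
   + (2 * C + poisson e 0) * (i.+1%:R ^+ 2)^-1))); last first.
  rewrite !big_split/= -mulr_suml -mulr_sumr -/(harm N).
  have h1 := sum_inv_near N X0; have h2 := @sum_invsq_le R N.
  have h3 : 0 <= 2 * C + poisson e 0 by lra.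
  have := ler_wpM2l h3 h2; lra.
rewrite split_form opprB addrA mulr_sumr -sumrN /harm -!big_split/=.
apply: ler_sum_nat => i /andP[_ iN].
have h := low i iN.
have r0 := damp_ge0 i C0; have r1 := damp_le1 i C0; have rC := damp_ge i C0.
have li : logS i <= logS N :> R by apply: le_logS; exact: ltnW.
have A0 : 0 <= poisson_primitive e (logS N - logS i).
  by rewrite poisson_primitive_ge0// subr_ge0.
have A1 := poisson_primitive_le e (logS N - logS i).
have hA : X <= logS N - logS i ->
  1 - 2 * poisson_primitive e (logS N - logS i) <= d by exact: hX.
have v0 : 0 <= i.+1%:R^-1 :> R by rewrite invr_ge0.
have tE : t i i = damp C i ^+ 2 * (poisson e 0 * i.+1%:R^-1 ^+ 2).
  by rewrite /t subrr invfM expr2; ring.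
rewrite tE -exprVn; move: h v0 rC hA A0 A1 r0 r1.
move: (\sum_(i <= j < N) t i j) (poisson_primitive _ _) (i.+1%:R^-1 : R) => S A v.
move: (damp C i) (logS N - logS i) (poisson e 0) P0 => r l P P0.
move=> h v0 rC hA A0 A1 r0 r1.
have h1 : r ^+ 2 * (P * v ^+ 2) <= P * v ^+ 2.
  by rewrite ler_piMl ?expr_le1// mulr_ge0// sqr_ge0.
have h2 : 1 - r ^+ 2 <= 2 * (C * v).
  have : 0 <= (1 - r) ^+ 2 by rewrite sqr_ge0.
  by lra.
have h3 : v * (1 - 2 * A) <= d * v + (if l < X then v else 0).
  case: ltP => lX.
    have : 0 <= d * v by rewrite mulr_ge0// ltW.
    have : 0 <= v * A by rewrite mulr_ge0.
    lra.
  by rewrite addr0 mulrC ler_wpM2r// hA.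
have h4 : 2 * A * (v * (1 - r ^+ 2)) <= v * (2 * (C * v)).
  apply: (@le_trans _ _ (v * (1 - r ^+ 2))).
    rewrite ler_piMl//; last by lra.
    by rewrite mulr_ge0// subr_ge0 expr_le1.
  by rewrite ler_wpM2l.
move: (if _ then _ else _) h3 => z h3.
(* The loss at one index splits exactly into missing kernel mass, damping, the diagonal, and the
   nonpositive defect [r ^+ 2 * v * A - S]. *)
have -> : v + r ^+ 2 * (P * v ^+ 2) - 2 * S = v * (1 - 2 * A)
  + 2 * A * (v * (1 - r ^+ 2)) + r ^+ 2 * (P * v ^+ 2)
  + 2 * (r ^+ 2 * v * A - S) by ring.
have -> : v * d + z + (2 * C + P) * v ^+ 2 =
  d * v + z + v * (2 * (C * v)) + P * v ^+ 2 by ring.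
lra.
Qed.

End PoissonForm.

(** * Quadratic forms of the kernel matrices *)

Section KernelForm.
Context {R : realType}.
Implicit Types (N : nat) (psi : R -> R) (t u : R).

Lemma Re_sum (I : Type) (s : seq I) (F : I -> R[i]) :
  complex.Re (\sum_(i <- s) F i) = \sum_(i <- s) complex.Re (F i).
Proof.
elim: s => [|i s IH]; first by rewrite !big_nil.
by rewrite !big_cons -IH; case: (F i) => a b; case: (\sum_(_ <- _) _) => c d.
Qed.

(** The squared modulus as a real number; the norm of [R[i]] takes values in [R[i]]. *)
Definition normsq (z : R[i]) : R := complex.Re z ^+ 2 + complex.Im z ^+ 2.

Lemma normsq_ge0 z : 0 <= normsq z.
Proof. by rewrite addr_ge0 ?sqr_ge0. Qed.

Lemma mul_conjc (z : R[i]) : z * z^*%C = (normsq z)%:C.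
Proof. by case: z => a b; rewrite /normsq/=; simpc; congr (_ +i* _); ring. Qed.

Lemma normsqM z w : normsq (z * w) = normsq z * normsq w.
Proof. by case: z w => [a b] [c d]; rewrite /normsq /=; ring. Qed.

Lemma normsqC (a : R) : normsq a%:C = a ^+ 2.
Proof. by rewrite /normsq /= expr0n addr0. Qed.

Lemma normsqJ z : normsq (z^*%C) = normsq z.
Proof. by case: z => a b; rewrite /normsq /= sqrrN. Qed.

Lemma normsq_expi t : normsq (expi t) = 1.
Proof. by rewrite /normsq /= cos2Dsin2. Qed.

(* The vector v_t with entries n^(-1/2 - i t), for which
   K_N(psi) = (2 pi)^-1 \int psi(t) v_t v_t^* dt. *)
Definition wave (i : nat) t : R[i] :=
  ((Num.sqrt i.+1%:R)^-1)%:C * expi (- (t * logS i)).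

(** The argument is a matrix rather than a vector because two kinds are inserted: rank one matrices,
    which give quadratic forms, and a transposed trial matrix, which gives the trace of a
    product. *)
Definition wave_form N (z : 'M[R[i]]_N) t : R :=
  complex.Re (\sum_n \sum_m z n m * (wave n t * (wave m t)^*%C)).

Definition kernel_form psi N (z : 'M[R[i]]_N) : R :=
  complex.Re (\sum_n \sum_m z n m * Kmx psi N n m).

Let wave_waveJ n m t : wave n t * (wave m t)^*%C =
  ((Num.sqrt (n.+1%:R * m.+1%:R))^-1)%:C * expi (- (t * (logS n - logS m))).
Proof.
rewrite /wave conjc_scale mulrACA -rmorphM/= sqrtrM ?ler0n// invfM; congr (_ * _).
rewrite mulrBr opprB addrC /expi/= cosD sinD !cosN !sinN.
by simpc; congr (_ +i* _); ring.
Qed.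

Lemma wave_formE N (z : 'M[R[i]]_N) t : wave_form z t =
  \sum_(n < N) \sum_(m < N) (Num.sqrt (n.+1%:R * m.+1%:R))^-1
    * (complex.Re (z n m) * cos (t * (logS n - logS m))
       + complex.Im (z n m) * sin (t * (logS n - logS m))).
Proof.
rewrite /wave_form Re_sum; apply: eq_bigr => n _.
rewrite Re_sum; apply: eq_bigr => m _; rewrite wave_waveJ.
by case: (z n m) => a b; rewrite /expi cosN sinN /=; ring.
Qed.

Lemma integrable_trig psi u a b : integrableR psi ->
  integrableR (fun t => psi t * (a * cos (t * u) + b * sin (t * u))).
Proof.
move=> psii.
have h1 := integrableRM psii (measurable_cosM u) (fun t => cos_max (t * u)).
have h2 := integrableRM psii (measurable_sinM u) (fun t => sin_max (t * u)).
apply: eq_integrableR (integrableRD (integrableRZ a h1) (integrableRZ b h2)) => t.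
by ring.
Qed.

Let Re_mulK psi N (n m : 'I_N) (z : R[i]) : integrableR psi ->
  complex.Re (z * Kmx psi N n m) = (2 * pi)^-1 *
    intR (fun t => psi t * ((Num.sqrt (n.+1%:R * m.+1%:R))^-1
    * (complex.Re z * cos (t * (logS n - logS m))
       + complex.Im z * sin (t * (logS n - logS m))))).
Proof.
move=> psii; rewrite mxE /fourier ln_div ?posrE ?ltr0n//.
rewrite -/(logS n) -/(logS m) /cintegral.
set u := logS n - logS m; set s := (Num.sqrt _)^-1.
have h1 := integrableRM psii (measurable_cosM u) (fun t => cos_max (t * u)).
have h2 := integrableRM psii (measurable_sinM u) (fun t => sin_max (t * u)).
have -> : intR (fun t => complex.Re ((psi t)%:C * expi (- (t * u)))) =
    intR (fun t => psi t * cos (t * u)).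
  by apply: eq_intR => t; rewrite /= cosN mul0r subr0.
have -> : intR (fun t => complex.Im ((psi t)%:C * expi (- (t * u)))) =
    - intR (fun t => psi t * sin (t * u)).
  by rewrite -intRN; apply: eq_intR => t; rewrite /= sinN mul0r addr0 mulrN.
rewrite [X in _ = _ * X](_ : _ =
    s * (complex.Re z * intR (fun t => psi t * cos (t * u))
         + complex.Im z * intR (fun t => psi t * sin (t * u)))).
  by case: z => a b /=; ring.
rewrite -intRZ// -(intRZ _ h2) -intRD ?integrableRZ// -intRZ; last first.
  by apply: integrableRD; apply: integrableRZ.
by apply: eq_intR => t; ring.
Qed.

Lemma integrable_wave_form psi N (z : 'M[R[i]]_N) : integrableR psi ->
  integrableR (fun t => psi t * wave_form z t).
Proof.
move=> psii; pose F (n m : 'I_N) t := psi t * ((Num.sqrt (n.+1%:R * m.+1%:R))^-1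
    * (complex.Re (z n m) * cos (t * (logS n - logS m))
       + complex.Im (z n m) * sin (t * (logS n - logS m)))).
have : integrableR (fun t => \sum_n \sum_m F n m t).
  apply: integrableR_sum => n; apply: integrableR_sum => m.
  pose s : R := (Num.sqrt (n.+1%:R * m.+1%:R))^-1.
  apply: eq_integrableR (integrable_trig (logS n - logS m)
    (s * complex.Re (z n m)) (s * complex.Im (z n m)) psii) => t.
  by rewrite /F -/s; ring.
apply: eq_integrableR => t; rewrite wave_formE mulr_sumr; apply: eq_bigr => n _.
by rewrite mulr_sumr.
Qed.

Lemma kernel_formE psi N (z : 'M[R[i]]_N) : integrableR psi ->
  kernel_form psi z = (2 * pi)^-1 * intR (fun t => psi t * wave_form z t).
Proof.
move=> psii; pose F (n m : 'I_N) t := psi t * ((Num.sqrt (n.+1%:R * m.+1%:R))^-1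
    * (complex.Re (z n m) * cos (t * (logS n - logS m))
       + complex.Im (z n m) * sin (t * (logS n - logS m)))).
have Fi n m : integrableR (F n m).
  pose s : R := (Num.sqrt (n.+1%:R * m.+1%:R))^-1.
  apply: eq_integrableR (integrable_trig (logS n - logS m)
    (s * complex.Re (z n m)) (s * complex.Im (z n m)) psii) => t.
  by rewrite /F -/s; ring.
rewrite /kernel_form Re_sum.
transitivity (\sum_n \sum_m (2 * pi)^-1 * intR (F n m)).
  by apply: eq_bigr => n _; rewrite Re_sum; apply: eq_bigr => m _; rewrite Re_mulK.
under eq_bigr do rewrite -mulr_sumr -intR_sum//.
rewrite -mulr_sumr -intR_sum; last by move=> n; exact: integrableR_sum.
congr (_ * _); apply: eq_intR => t; rewrite wave_formE mulr_sumr.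
by apply: eq_bigr => n _; rewrite mulr_sumr.
Qed.

Lemma continuous_wave_form N (z : 'M[R[i]]_N) : continuous (wave_form z).
Proof.
have sum_cont (I : Type) (s : seq I) (F : I -> R -> R) :
    (forall i, continuous (F i)) -> continuous (fun t => \sum_(i <- s) F i t).
  move=> cF; elim: s => [|i s IH].
    rewrite (_ : (fun t => _) = fun=> 0); first exact: continuous_cst_fun.
    by apply/funext => t; rewrite big_nil.
  rewrite (_ : (fun t => _) = fun t => F i t + \sum_(i <- s) F i t).
    exact: continuousD_fun.
  by apply/funext => t; rewrite big_cons.
rewrite (funext (wave_formE z)).
apply: (sum_cont _ _ _) => n; apply: (sum_cont _ _ _) => m.
have lin u : continuous (fun t : R => t * u).
  by apply: continuousM_fun; [exact: continuous_id_fun|exact: continuous_cst_fun].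
apply: continuousM_fun; first exact: continuous_cst_fun.
apply: continuousD_fun; apply: continuousM_fun; try exact: continuous_cst_fun.
  exact: (continuous_comp_fun (@continuous_cos R)).
exact: (continuous_comp_fun (@continuous_sin R)).
Qed.

(** The pairing is with the sum of [c n * wave n t], without conjugation; this is why the entries of
    v_s enter conjugated below. *)
Definition rank1 N (c : 'I_N -> R[i]) : 'M[R[i]]_N :=
  \matrix_(n, m) (c n * (c m)^*%C).

Lemma wave_form_rank1 N (c : 'I_N -> R[i]) t :
  wave_form (rank1 c) t = normsq (\sum_n c n * wave n t).
Proof.
rewrite /wave_form (_ : normsq _ = complex.Re ((normsq (\sum_n c n * wave n t))%:C))//.
rewrite -mul_conjc rmorph_sum/= mulr_suml; congr complex.Re.
apply: eq_bigr => n _; rewrite mulr_sumr; apply: eq_bigr => m _.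
by rewrite mxE rmorphM/=; ring.
Qed.

Lemma wave_form_rank1_ge0 N (c : 'I_N -> R[i]) t : 0 <= wave_form (rank1 c) t.
Proof. by rewrite wave_form_rank1 normsq_ge0. Qed.

End KernelForm.

(** * Bessel's inequality and the Fejer-type kernel *)

Section Bessel.
Context {R : realType}.
Implicit Types (N : nat) (e C s t : R) (chi : R -> R).

Lemma Kmx_expw e N (n m : 'I_N) : 0 < e -> Kmx (expw e) N n m =
  ((Num.sqrt (n.+1%:R * m.+1%:R))^-1 * poisson e (logS n - logS m))%:C.
Proof.
move=> e0; rewrite mxE /fourier ln_div ?posrE ?ltr0n//.
rewrite -/(logS n) -/(logS m) /cintegral; set u := logS n - logS m.
have -> : intR (fun t => complex.Re ((expw e t)%:C * expi (- (t * u)))) =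
    2 * e / (e ^+ 2 + u ^+ 2).
  rewrite -intR_expw_cos//; apply: eq_intR => t.
  by rewrite /= cosN mul0r subr0.
have -> : intR (fun t => complex.Im ((expw e t)%:C * expi (- (t * u)))) = 0.
  apply: (@oppr_inj R); rewrite oppr0 -intRN -(intR_expw_sin u e0).
  by apply: eq_intR => t; rewrite /= sinN mul0r addr0 mulrN opprK.
have -> : poisson e u = (2 * pi)^-1 * (2 * e / (e ^+ 2 + u ^+ 2)).
  have p0 : (pi : R) != 0 by rewrite gt_eqF ?pi_gt0.
  have eu0 : e ^+ 2 + u ^+ 2 != 0.
    by rewrite gt_eqF// ltr_wpDr ?sqr_ge0// exprn_gt0.
  by rewrite /poisson; move: (pi : R) p0 => p p0; field; rewrite p0 eu0.
by rewrite complexr0 -!rmorphM.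
Qed.

Lemma Re_mul_conjc_le (z w : R[i]) :
  complex.Re (z * w^*%C) <= Num.sqrt (normsq z) * Num.sqrt (normsq w).
Proof.
rewrite -sqrtrM ?normsq_ge0// -(normsqJ w) -normsqM.
apply: le_trans (ler_norm _) _; rewrite -sqrtr_sqr ler_sqrt ?normsq_ge0//.
by rewrite lerDl sqr_ge0.
Qed.

(** The damped Poisson matrix has nonnegative entries, so [c] may be replaced by its moduli, which
    leaves the real inequality [poisson_schur]. *)
Lemma bessel e C N (c : 'I_N -> R[i]) : 0 < e -> poisson e 0 + 2^-1 <= C ->
  kernel_form (expw e) (rank1 (fun n => (damp C n)%:C * c n))
  <= \sum_n normsq (c n).
Proof.
move=> e0 PC.
have C0 : 0 <= C by have := poisson_ge0 0 e0; lra.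
pose x k : R := if insub k is Some i then Num.sqrt (normsq (c i)) else 0.
have xE (i : 'I_N) : x i = Num.sqrt (normsq (c i)) by rewrite /x valK.
have x0 k : 0 <= x k by rewrite /x; case: insub.
have := poisson_schur N e0 PC x0; rewrite !big_mkord.
under eq_bigr do rewrite big_mkord.
under [X in _ <= X -> _]eq_bigr do rewrite xE sqr_sqrtr ?normsq_ge0//.
apply: le_trans; rewrite /kernel_form Re_sum; apply: ler_sum => n _.
rewrite Re_sum; apply: ler_sum => m _; rewrite Kmx_expw// mxE !xE.
rewrite conjc_scale mulrACA -rmorphM/= mulrAC -rmorphM/=.
set P := poisson e _; set a := damp C n * damp C m * (_ * P).
have -> : damp C n * damp C m * P * ((Num.sqrt (n.+1%:R * m.+1%:R))^-1 *
    (Num.sqrt (normsq (c n)) * Num.sqrt (normsq (c m)))) =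
    a * (Num.sqrt (normsq (c n)) * Num.sqrt (normsq (c m))).
  by rewrite /a; ring.
have -> : complex.Re (a%:C * (c n * (c m)^*%C)) = a * complex.Re (c n * (c m)^*%C).
  by case: (_ * _^*%C) => p q /=; rewrite mul0r subr0.
rewrite ler_wpM2l ?Re_mul_conjc_le// /a mulr_ge0//; last first.
  by rewrite mulr_ge0 ?poisson_ge0// invr_ge0.
by rewrite mulr_ge0 ?damp_ge0.
Qed.

Lemma intR_shift (G : R -> R) s : continuous G -> (forall t, 0 <= G t) ->
  intR (fun t => G (t - s)) = intR G.
Proof.
move=> cG G0; rewrite /Rintegral; congr fine.
pose F t : R := t - s.
have dF t : is_derive t 1 F 1.
  by rewrite -[X in is_derive _ _ _ X]addr0; apply: is_deriveD_fun.
have F' : derive1 F = cst 1.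
  by apply/funext => t; rewrite derive1E; case: (dF t).
rewrite [RHS](increasing_ge0_integration_by_substitutionT (F := F))//.
- by apply: eq_integral => t _; rewrite F' /= mulr1.
- by move=> x y xy; rewrite /F ltrD2r.
- by rewrite F' => ? ; exact: cst_continuous.
- by rewrite F'; exact: is_cvg_cst.
- by rewrite F'; exact: is_cvg_cst.
- apply/cvgrNyPle => A; near=> t; rewrite /F lerBlDr; near: t.
  exact: nbhs_ninfty_le (num_real _).
- apply/cvgryPge => A; near=> t; rewrite /F lerBrDr; near: t.
  exact: nbhs_pinfty_ge (num_real _).
Unshelve. all: by end_near. Qed.

(** The squared modulus of the damped Dirichlet polynomial with terms n^(-1 - i u). It plays the
    part of a Fejer kernel, with mass of order H_N under the exponential weight. *)
Definition fejer C N u : R :=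
  wave_form (rank1 (fun n : 'I_N => (damp C n)%:C * (wave n 0)^*%C)) u.

Lemma wave0 n : wave n 0 = ((Num.sqrt n.+1%:R)^-1)%:C :> R[i].
Proof. by rewrite /wave mul0r oppr0 /expi cos0 sin0; simpc. Qed.

Lemma wave_form_damp C N s t :
  wave_form (rank1 (fun n : 'I_N => (damp C n)%:C * (wave n s)^*%C)) t =
  fejer C N (t - s).
Proof.
rewrite /fejer !wave_form_rank1; congr normsq; apply: eq_bigr => n _.
rewrite wave0 /wave conjc_real conjc_scale.
have -> : expi (- ((t - s) * logS n)) =
    (expi (- (s * logS n)))^*%C * expi (- (t * logS n)).
  rewrite mulrBl opprB addrC /expi cosD sinD !cosN !sinN.
  by simpc; congr (_ +i* _); ring.
by ring.
Qed.

Lemma fejer_ge0 C N u : 0 <= fejer C N u.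
Proof. exact: wave_form_rank1_ge0. Qed.

Lemma normsq_wave n t : normsq (wave n t) = n.+1%:R^-1.
Proof. by rewrite normsqM normsq_expi mulr1 normsqC exprVn sqr_sqrtr. Qed.

Lemma kernel_form_expw_fejer e C N : 0 < e ->
  (2 * pi)^-1 * intR (fun t => expw e t * fejer C N t) = poisson_form e C N.
Proof.
move=> e0; rewrite -kernel_formE; last exact: integrable_expw.
rewrite /poisson_form big_mkord /kernel_form Re_sum; apply: eq_bigr => n _.
rewrite big_mkord Re_sum; apply: eq_bigr => m _.
rewrite mxE Kmx_expw// sqrtrM ?ler0n// !wave0 !conjc_scale !conjc_real.
have ReM (a b c d k : R) :
    complex.Re (a%:C * b%:C * (c%:C * d%:C) * k%:C) = a * b * (c * d) * k.
  by rewrite -!rmorphM.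
rewrite ReM -[in RHS](@sqr_sqrtr _ n.+1%:R)//.
rewrite -[in RHS](@sqr_sqrtr _ m.+1%:R)//.
have sn : Num.sqrt n.+1%:R != 0 :> R by rewrite gt_eqF// sqrtr_gt0.
have sm : Num.sqrt m.+1%:R != 0 :> R by rewrite gt_eqF// sqrtr_gt0.
move: (poisson _ _) (damp C n) (damp C m) (Num.sqrt n.+1%:R : R)
  (Num.sqrt m.+1%:R : R) sn sm => P p q x y x0 y0.
by field; rewrite x0 y0.
Qed.

Lemma intR_expw_fejer e C N s : 0 < e ->
  (2 * pi)^-1 * intR (fun t => expw e (t - s) * fejer C N (t - s)) =
  poisson_form e C N.
Proof.
move=> e0; rewrite (intR_shift (G := fun t => expw e t * fejer C N t)).
- exact: kernel_form_expw_fejer.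
- apply: continuousM_fun; first exact: continuous_expw.
  exact: continuous_wave_form.
- by move=> t; rewrite mulr_ge0 ?expw_ge0 ?fejer_ge0.
Qed.

Lemma sum_inv_ord N : \sum_(n < N) n.+1%:R^-1 = harm N :> R.
Proof. by rewrite /harm big_mkord. Qed.

Lemma poisson_form_le e C N : 0 < e -> poisson e 0 + 2^-1 <= C ->
  poisson_form e C N <= harm N.
Proof.
move=> e0 PC; rewrite -kernel_form_expw_fejer// /fejer -kernel_formE.
  apply: le_trans (bessel _ e0 PC) _; rewrite -sum_inv_ord.
  by apply: ler_sum => n _; rewrite normsqJ normsq_wave.
exact: integrable_expw.
Qed.

End Bessel.

(** * Convergence of the smoothed test function *)

Section ApproximateIdentity.
Context {R : realType}.
Variables (e C : R) (chi : R -> R).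
Hypotheses (e0 : 0 < e) (eC : poisson e 0 + 2^-1 <= C).
Hypotheses (chi_cont : continuous chi) (chi_ge0 : forall t, 0 <= chi t).
Hypothesis (chi_le : forall t, chi t <= expw e t).

(** The quadratic form of the damped trial matrix at v_s, which is a convolution of [chi] with
    [fejer]; divided by H_N it recovers [chi s] in the limit. *)
Definition smoothed N s : R :=
  kernel_form chi (rank1 (fun n : 'I_N => (damp C n)%:C * (wave n s)^*%C)).

Let chi_int : integrableR chi.
Proof.
apply: le_integrableR (integrable_expw e0).
  exact: continuous_measurable_fun.
by move=> t; rewrite ger0_norm.
Qed.

Let C0 : 0 <= C. Proof. by apply: le_trans eC; rewrite addr_ge0 ?invr_ge0 ?poisson_ge0. Qed.

Let pi2_ge0 : 0 <= (2 * pi)^-1 :> R.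
Proof. by rewrite invr_ge0 mulr_ge0 ?pi_ge0. Qed.

Lemma smoothedE N s :
  smoothed N s = (2 * pi)^-1 * intR (fun t => chi t * fejer C N (t - s)).
Proof.
rewrite /smoothed kernel_formE//; congr (_ * _); apply: eq_intR => t.
by rewrite wave_form_damp.
Qed.

Lemma kernel_form_mono psi1 psi2 N (c : 'I_N -> R[i]) :
  integrableR psi1 -> integrableR psi2 -> (forall t, psi1 t <= psi2 t) ->
  kernel_form psi1 (rank1 c) <= kernel_form psi2 (rank1 c).
Proof.
move=> i1 i2 le12; rewrite !kernel_formE// ler_wpM2l//.
apply: le_intR; [exact: integrable_wave_form|exact: integrable_wave_form|].
by move=> t; rewrite ler_wpM2r ?wave_form_rank1_ge0.
Qed.

Lemma kernel_form_chi_le N (c : 'I_N -> R[i]) :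
  kernel_form chi (rank1 (fun n => (damp C n)%:C * c n)) <= \sum_n normsq (c n).
Proof.
apply: le_trans (bessel c e0 eC); apply: kernel_form_mono => //.
exact: integrable_expw.
Qed.

Lemma kernel_form_chi_ge0 N (c : 'I_N -> R[i]) : 0 <= kernel_form chi (rank1 c).
Proof.
rewrite kernel_formE// mulr_ge0//; apply: intR_ge0 => t.
by rewrite mulr_ge0 ?wave_form_rank1_ge0.
Qed.

Lemma smoothed_ge0 N s : 0 <= smoothed N s.
Proof. exact: kernel_form_chi_ge0. Qed.

Lemma smoothed_le N s : smoothed N s <= harm N.
Proof.
apply: le_trans (kernel_form_chi_le _) _; rewrite -sum_inv_ord.
by apply: ler_sum => n _; rewrite normsqJ normsq_wave.
Qed.

Let expwD s t : expw e t <= expR (e * `|s|) * expw e (t - s).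
Proof.
rewrite /expw -expRD ler_expR.
have : e * `|t - s| <= e * (`|t| + `|s|) by rewrite ler_pM2l// ler_normB.
rewrite mulrDr => h; lra.
Qed.

(* Far from s, the weight is dominated by the gap between the exponential
   weights of parameters e and 2e, whose smoothed masses agree asymptotically. *)
Let pointwise s (d : R) : 0 < d -> exists2 M : R, 0 <= M & forall t,
  `|chi t - chi s * expw e (t - s)| <=
  d * expw e (t - s) + M * (expw e (t - s) - expw (2 * e) (t - s)).
Proof.
move=> d0.
pose h t := chi t * expR (e * `|t - s|).
have ch : continuous h.
  apply: continuousM_fun => //; apply: (continuous_comp_fun (@continuous_expR R)).
  apply: continuousM_fun; first exact: continuous_cst_fun.
  apply: (@continuous_comp_fun _ (fun x => `|x|)).
    by move=> x; exact: norm_continuous.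
  by apply: continuousD_fun; [exact: continuous_id_fun|exact: continuous_cst_fun].
have hs : h s = chi s by rewrite /h subrr normr0 mulr0 expR0 mulr1.
have /cvgrPdist_le /(_ _ d0) := ch s; rewrite hs => -[r /= r0 hr].
(* For [|t - s| >= r] the weight w = [expw e (t - s)] is at most 1 - q, so the gap w - w^2 is at
   least q w, while the left side is at most (exp(e |s|) + 1) w. Their ratio is the constant M. *)
pose q := 1 - expR (- (e * r)).
have q0 : 0 < q by rewrite subr_gt0 expR_lt1 oppr_lt0 mulr_gt0.
have M0 : 0 <= (expR (e * `|s|) + 1) / q.
  by rewrite divr_ge0 ?(ltW q0)// addr_ge0 ?expR_ge0.
exists ((expR (e * `|s|) + 1) / q) => //.
move=> t; have w0 := expw_ge0 e (t - s).
have w2 : expw (2 * e) (t - s) = expw e (t - s) * expw e (t - s).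
  by rewrite /expw -expRD; congr expR; ring.
have w1 := expw_le1 (t - s) (ltW e0).
have [ts|st] := ltP `|s - t| r.
  have ht : chi t - chi s * expw e (t - s) = (h t - chi s) * expw e (t - s).
    by rewrite mulrBl /h -mulrA -expRD subrr expR0 mulr1.
  rewrite ht normrM (ger0_norm w0).
  apply: (@le_trans _ _ (d * expw e (t - s))).
    by rewrite ler_wpM2r// distrC; exact: hr.
  by rewrite lerDl mulr_ge0// w2 subr_ge0 ler_piMl.
have wq : expw e (t - s) <= 1 - q.
  by rewrite /q subKr ler_expR lerN2 ler_pM2l// distrC.
apply: (@le_trans _ _ ((expR (e * `|s|) + 1) * expw e (t - s))).
  rewrite (le_trans (ler_normB _ _))// ger0_norm// ger0_norm; last by rewrite mulr_ge0.
  rewrite mulrDl mul1r lerD//; first exact: le_trans (chi_le t) (expwD s t).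
  by rewrite ler_piMl// (le_trans (chi_le s))// expw_le1// ltW.
apply: (@le_trans _ _ ((expR (e * `|s|) + 1) / q *
    (expw e (t - s) - expw (2 * e) (t - s)))); last first.
  by rewrite lerDr mulr_ge0// ltW.
rewrite -mulrA ler_wpM2l ?addr_ge0 ?expR_ge0// w2 mulrC ler_pdivlMr//.
rewrite -{2}(mulr1 (expw e _)) -mulrBr ler_wpM2l//; lra.
Qed.

(** Integrating the bound of [pointwise] against [fejer] leaves only Poisson forms, which are
    asymptotic to H_N. Concentration of [fejer] near 0 thus follows from masses alone, without
    estimating its decay. *)
Lemma smoothed_cvg s (d : R) : 0 < d -> exists K : R, forall N,
  `|smoothed N s - chi s * harm N| <= d * harm N + K.
Proof.
move=> d0.
have d30 : 0 < d / 3 by rewrite divr_gt0.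
have [M M0 hM] := pointwise s d30.
have e20 : 0 < 2 * e by rewrite mulr_gt0.
have M1 : 0 < M + 1 by lra.
(* The tolerance for the parameter [2 * e] gets multiplied by [M] below; [M + 1] avoids a division
   by zero. *)
have d3M : 0 < d / 3 / (M + 1) by rewrite divr_gt0.
have [K2 hK2] := poisson_form_lower e20 C0 d3M.
have [K1 hK1] := poisson_form_lower e0 C0 d30.
exists (M * K2 + K1) => N.
have TH := poisson_form_le N e0 eC.
have H0 := @harm_ge0 R N.
have ie f : 0 < f -> integrableR (fun t => expw f (t - s) * fejer C N (t - s)).
  move=> f0.
  have i0 : integrableR (fun t => expw f (t - s)).
    apply: le_integrableR (integrableRZ (expR (f * `|s|)) (integrable_expw f0)).
      apply: continuous_measurable_fun.
      apply: (continuous_comp_fun (@continuous_expw _ f)).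
      by apply: continuousD_fun; [exact: continuous_id_fun|exact: continuous_cst_fun].
    move=> t; rewrite ger0_norm ?expw_ge0// /expw -expRD ler_expR.
    have : f * `|t| <= f * (`|t - s| + `|s|).
      by rewrite ler_pM2l// -{1}(subrK s t) ler_normD.
    rewrite mulrDr => h; lra.
  have := integrable_wave_form (rank1 (fun n : 'I_N => (damp C n)%:C * (wave n s)^*%C)) i0.
  by apply: eq_integrableR => t; rewrite wave_form_damp.
have ichi : integrableR (fun t => chi t * fejer C N (t - s)).
  have := integrable_wave_form (rank1 (fun n : 'I_N => (damp C n)%:C * (wave n s)^*%C)) chi_int.
  by apply: eq_integrableR => t; rewrite wave_form_damp.
have key : `|smoothed N s - chi s * poisson_form e C N| <=
    d / 3 * poisson_form e C N
    + M * (poisson_form e C N - poisson_form (2 * e) C N).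
  rewrite smoothedE -!(intR_expw_fejer _ _ s)//.
  have i1 := ie _ e0; have i2 := ie _ e20.
  have iM := integrableRZ M (integrableRB i1 i2).
  have id3 := integrableRZ (d / 3) i1.
  have ics := integrableRZ (chi s) i1.
  set I0 := Rintegral _ _ _; set I1 := Rintegral _ _ _; set I2 := Rintegral _ _ _.
  set c := (2 * pi)^-1.
  have -> : c * I0 - chi s * (c * I1) = c * (I0 - chi s * I1) by ring.
  have -> : d / 3 * (c * I1) + M * (c * I1 - c * I2) =
    c * (d / 3 * I1 + M * (I1 - I2)) by ring.
  rewrite normrM (ger0_norm pi2_ge0) ler_wpM2l// /I0 /I1 /I2.
  rewrite -(intRZ (chi s) i1) -(intRZ (d / 3) i1) -(intRB i1 i2).
  rewrite -(intRZ M (integrableRB i1 i2)) -(intRB ichi ics) -(intRD id3 iM).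
  apply: le_trans (le_normr_Rintegral _ (integrableRB ichi ics)) _ => //.
  apply: le_intR; [exact/integrable_norm/integrableRB|exact: integrableRD|move=> t].
  rewrite mulrA -mulrBl normrM (ger0_norm (fejer_ge0 _ _ _)) mulrA -mulrBl mulrA.
  by rewrite -mulrDl ler_wpM2r ?fejer_ge0.
have h2 : M * (poisson_form e C N - poisson_form (2 * e) C N)
    <= d / 3 * harm N + M * K2.
  have : poisson_form e C N - poisson_form (2 * e) C N <=
    d / 3 / (M + 1) * harm N + K2 by have := hK2 N; lra.
  move/(ler_wpM2l M0) => /le_trans; apply.
  rewrite mulrDr lerD2r mulrA ler_wpM2r// mulrA ler_pdivrMr// mulrC.
  by rewrite ler_wpM2l ?(ltW d30)// lerDl.
have h3 : `|chi s * (poisson_form e C N - harm N)| <= d / 3 * harm N + K1.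
  rewrite normrM ger0_norm// distrC ger0_norm ?subr_ge0//.
  apply: le_trans (hK1 N); rewrite ler_piMl ?subr_ge0//.
  by rewrite (le_trans (chi_le s))// expw_le1// ltW.
have -> : smoothed N s - chi s * harm N = (smoothed N s - chi s * poisson_form e C N)
  + chi s * (poisson_form e C N - harm N) by ring.
apply: le_trans (ler_normD _ _) _.
have h4 : d / 3 * poisson_form e C N <= d / 3 * harm N by rewrite ler_wpM2l// ltW.
lra.
Qed.

End ApproximateIdentity.

(** * Traces of ramp functions *)

(** Compares a full coefficient y + z with its damped part y. The remainder z can afford the large
    factor 1/d because its total contribution to the trace is bounded in N. *)
Lemma normsqD_ge (R : realType) (d : R) (y z : R[i]) : 0 < d -> d <= 1 ->
  (1 - d) * normsq (y + z) <= normsq y + normsq z / d.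
Proof.
move=> d0 d1; have sq p q : (1 - d) * (p + q) ^+ 2 <= p ^+ 2 + q ^+ 2 / d.
  rewrite -subr_ge0.
  have -> : p ^+ 2 + q ^+ 2 / d - (1 - d) * (p + q) ^+ 2 =
      (d * p - (1 - d) * q) ^+ 2 / d + q ^+ 2.
    by field; rewrite gt_eqF.
  by rewrite addr_ge0 ?sqr_ge0// divr_ge0 ?sqr_ge0// ltW.
case: y z => [p q] [p' q']; rewrite /normsq/=.
have := sq p p'; have := sq q q'; rewrite mulrDr mulrDl => h1 h2; lra.
Qed.

Section SpectralSums.
Context {R : realType}.
Local Arguments conjc : simpl never.
Variables (N : nat) (phi : R -> R) (U : 'M[R[i]]_N) (lam : 'I_N -> R).
Hypothesis (phi_int : integrableR phi).
Hypothesis (U_rows : forall j k, \sum_n U j n * (U k n)^*%C = (j == k)%:R).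
Hypothesis (U_cols : forall n m, \sum_j U j n * (U j m)^*%C = (n == m)%:R).
Hypothesis (phiE : forall n m,
  Kmx phi N n m = \sum_j (lam j)%:C * ((U j n)^*%C * U j m)).

Lemma eigenvalueE j : lam j = kernel_form phi (rank1 (U j)).
Proof.
rewrite /kernel_form; apply: (@complexI R).
have -> : \sum_n \sum_m rank1 (U j) n m * Kmx phi N n m =
    \sum_k (lam k)%:C * ((\sum_n U j n * (U k n)^*%C)
      * (\sum_m U k m * (U j m)^*%C)).
  transitivity (\sum_n \sum_m \sum_k
      (lam k)%:C * (U j n * (U k n)^*%C * (U k m * (U j m)^*%C))).
    apply: eq_bigr => n _; apply: eq_bigr => m _; rewrite phiE mxE mulr_sumr.
    by apply: eq_bigr => k _; ring.
  under eq_bigr do rewrite exchange_big/=.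
  rewrite exchange_big/=; apply: eq_bigr => k _.
  rewrite mulr_suml mulr_sumr; apply: eq_bigr => n _.
  by rewrite mulr_sumr mulr_sumr; apply: eq_bigr => m _; ring.
rewrite (bigD1 j)//= !U_rows eqxx !mulr1 big1 ?addr0// => k kj.
by rewrite U_rows eq_sym (negbTE kj) mul0r mulr0.
Qed.

(** Parseval in the eigenbasis. Independence of t, due to |v_t(n)|^2 = 1/n, is what makes the traces
    of kernel forms factor. *)
Lemma sum_wave_form (r : nat -> R) t :
  \sum_j wave_form (rank1 (fun n : 'I_N => (r n)%:C * U j n)) t =
  \sum_(n < N) r n ^+ 2 / n.+1%:R.
Proof.
rewrite /wave_form -Re_sum.
rewrite (_ : \sum_(n < N) _ = complex.Re (\sum_(n < N) r n ^+ 2 / n.+1%:R)%:C)//.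
congr complex.Re; rewrite exchange_big/= rmorph_sum/=; apply: eq_bigr => n _.
rewrite exchange_big/= (bigD1 n)//= [X in _ + X]big1 ?addr0; last first.
  move=> m mn; under eq_bigr do rewrite mxE conjc_scale.
  rewrite (eq_bigr (fun j => ((r n)%:C * (r m)%:C * (wave n t * (wave m t)^*%C))
    * (U j n * (U j m)^*%C))); last by move=> j _; ring.
  by rewrite -mulr_sumr U_cols eq_sym (negbTE mn) mulr0.
under eq_bigr do rewrite mxE conjc_scale.
rewrite (eq_bigr (fun j => ((r n)%:C * (r n)%:C * (wave n t * (wave n t)^*%C))
  * (U j n * (U j n)^*%C))); last by move=> j _; ring.
rewrite -mulr_sumr U_cols eqxx mulr1 mul_conjc normsq_wave.
by rewrite -!rmorphM.
Qed.

Lemma sum_kernel_form psi (r : nat -> R) : integrableR psi ->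
  \sum_j kernel_form psi (rank1 (fun n : 'I_N => (r n)%:C * U j n)) =
  (2 * pi)^-1 * intR psi * \sum_(n < N) r n ^+ 2 / n.+1%:R.
Proof.
move=> psii; under eq_bigr do rewrite kernel_formE//.
rewrite -mulr_sumr -intR_sum; last by move=> j; exact: integrable_wave_form.
rewrite -mulrA; congr (_ * _); rewrite mulrC -intRZ//; apply: eq_intR => t.
by rewrite -mulr_sumr sum_wave_form mulrC.
Qed.

Lemma sum_normsq_row j : \sum_n normsq (U j n) = 1.
Proof.
apply: (@complexI R); rewrite rmorph_sum/=.
transitivity (\sum_n U j n * (U j n)^*%C); last by rewrite U_rows eqxx.
by apply: eq_bigr => n _; rewrite mul_conjc.
Qed.

Section Smoothing.
Variables (e C : R) (chi : R -> R).
Hypotheses (e0 : 0 < e) (eC : poisson e 0 + 2^-1 <= C).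
Hypotheses (chi_cont : continuous chi) (chi_ge0 : forall t, 0 <= chi t).
Hypothesis (chi_le : forall t, chi t <= expw e t).

(** Transposed, because [wave_form] and [kernel_form] multiply entries at equal positions, whereas
    the trace of a product pairs (n, m) with (m, n). *)
Let trz : 'M[R[i]]_N :=
  \matrix_(m, n) ((damp C n)%:C * (damp C m)%:C * Kmx chi N n m).

Let smoothed_trz s : wave_form trz s = smoothed C chi N s.
Proof.
rewrite /wave_form /smoothed /kernel_form exchange_big/=; congr complex.Re.
apply: eq_bigr => n _; apply: eq_bigr => m _.
by rewrite [trz m n]mxE [rank1 _ n m]mxE (conjc_scale (damp C m)) conjcK; ring.
Qed.

Lemma integrable_smoothed : integrableR (fun s => phi s * smoothed C chi N s).
Proof.
apply: eq_integrableR (integrable_wave_form trz phi_int) => s.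
by rewrite smoothed_trz.
Qed.

(** Both sides are the trace of K_N(phi) times the damped trial matrix: on the left in the
    eigenbasis, on the right through the superposition of K_N(phi) over the v_s. *)
Lemma sum_eigenvalue_kernel_form :
  \sum_j lam j * kernel_form chi (rank1 (fun n : 'I_N => (damp C n)%:C * U j n)) =
  (2 * pi)^-1 * intR (fun s => phi s * smoothed C chi N s).
Proof.
transitivity (kernel_form phi trz); last first.
  rewrite kernel_formE//; congr (_ * _); apply: eq_intR => s.
  by rewrite smoothed_trz.
have ReZ (a : R) z : a * complex.Re z = complex.Re (a%:C * z).
  by case: z => p q /=; rewrite mul0r subr0.
rewrite /kernel_form; under eq_bigr do rewrite ReZ.
rewrite -Re_sum; congr complex.Re.
transitivity (\sum_j \sum_(n < N) \sum_(m < N) (damp C n)%:C * (damp C m)%:C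
    * Kmx chi N n m * ((lam j)%:C * ((U j m)^*%C * U j n))).
  apply: eq_bigr => j _; rewrite mulr_sumr; apply: eq_bigr => n _.
  rewrite mulr_sumr; apply: eq_bigr => m _.
  by rewrite mxE (conjc_scale (damp C m)); ring.
rewrite exchange_big/= [RHS]exchange_big/=; apply: eq_bigr => n _.
rewrite exchange_big/=; apply: eq_bigr => m _.
by rewrite -mulr_sumr -phiE [trz m n]mxE.
Qed.

(** Variational principle: the ramp at x is at least (x - a) M for every M in [0, 1]. The diagonal
    entries [M j] of the damped trial matrix in the eigenbasis lie there by positivity and Bessel's
    inequality; since a >= 0, the trace of that matrix may be replaced by its undamped bound. *)
Lemma sum_ramp_ge (a : R) : 0 <= a ->
  (2 * pi)^-1 * intR (fun s => phi s * smoothed C chi N s)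
  - a * harm N * ((2 * pi)^-1 * intR chi) <= \sum_j Num.max (lam j - a) 0.
Proof.
move=> a0.
have C0 : 0 <= C by apply: le_trans eC; rewrite addr_ge0 ?invr_ge0 ?poisson_ge0.
have chi_int : integrableR chi.
  apply: le_integrableR (integrable_expw e0); first exact: continuous_measurable_fun.
  by move=> t; rewrite ger0_norm.
pose M j := kernel_form chi (rank1 (fun n : 'I_N => (damp C n)%:C * U j n)).
apply: (@le_trans _ _ (\sum_j (lam j - a) * M j)).
  under eq_bigr do rewrite mulrBl.
  rewrite sumrB sum_eigenvalue_kernel_form lerD2l lerN2 -mulr_sumr.
  rewrite sum_kernel_form// -[leRHS]mulrA ler_wpM2l//.
  rewrite mulrC ler_wpM2r ?mulr_ge0 ?invr_ge0 ?mulr_ge0 ?pi_ge0 ?intR_ge0//.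
  rewrite -sum_inv_ord; apply: ler_sum => n _.
  by rewrite ler_piMl ?invr_ge0// expr_le1 ?damp_le1 ?damp_ge0.
apply: ler_sum => j _.
have M0 : 0 <= M j by apply: (kernel_form_chi_ge0 e0 chi_cont chi_ge0 chi_le).
have M1 : M j <= 1.
  by rewrite -(sum_normsq_row j); apply: (kernel_form_chi_le e0 eC chi_cont chi_ge0 chi_le).
rewrite le_max; have [la|la] := leP (lam j - a) 0.
  by rewrite orbC mulr_le0_ge0.
by rewrite ler_piMr// ltW.
Qed.

End Smoothing.

(** Bessel's inequality is one-sided and concerns damped coefficients. So the constant a >= 0 is
    exchanged for a times the damped exponential form, and damped coefficients for full ones at
    relative cost d. There remain the positive part of phi - (1 - d) a e^(-e|t|) and a term that
    Parseval bounds independently of N. *)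
Lemma sum_ramp_le (a e C d : R) : 0 <= a -> 0 < e -> poisson e 0 + 2^-1 <= C ->
  0 < d -> d <= 1 ->
  \sum_j Num.max (lam j - a) 0 <=
  harm N * ((2 * pi)^-1 *
    intR (fun t => Num.max (phi t - (1 - d) * a * expw e t) 0))
  + a / d * ((2 * pi)^-1 * (2 / e) * (2 * C ^+ 2)).
Proof.
move=> a0 e0 eC d0 d1.
have C0 : 0 <= C by apply: le_trans eC; rewrite addr_ge0 ?invr_ge0 ?poisson_ge0.
have iw := @integrable_expw R e e0.
pose psi t := phi t - (1 - d) * a * expw e t.
have ipsi : integrableR psi by apply: integrableRB => //; exact: integrableRZ.
have imax : integrableR (fun t => Num.max (psi t) 0).
  apply: le_integrableR (integrable_norm ipsi) => //.
    apply: measurable_maxr; last exact: measurable_cst.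
    exact: integrableR_measurable.
  by move=> t; rewrite ger0_norm ?le_max ?lexx ?orbT// ge_max ler_norm normr_ge0.
have pi2 : 0 <= (2 * pi)^-1 :> R by rewrite invr_ge0 mulr_ge0 ?pi_ge0.
pose cz j := fun n : 'I_N => (1 - damp C n)%:C * U j n.
have iq := integrable_wave_form.
have main j : Num.max (lam j - a) 0 <=
    kernel_form (fun t => Num.max (psi t) 0) (rank1 (fun n : 'I_N => (1 : R)%:C * U j n))
    + a / d * kernel_form (expw e) (rank1 (cz j)).
  rewrite !kernel_formE// ge_max; apply/andP; split; last first.
    rewrite addr_ge0 ?mulr_ge0 ?(ltW d0) ?invr_ge0//; try exact: ltW.
    - by rewrite mulr_ge0 ?pi_ge0.
    - by apply: intR_ge0 => t; rewrite mulr_ge0 ?wave_form_rank1_ge0// le_max lexx orbT.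
    - by rewrite mulr_ge0 ?pi_ge0.
    - by apply: intR_ge0 => t; rewrite mulr_ge0 ?wave_form_rank1_ge0 ?expw_ge0.
  have m1 : kernel_form (expw e) (rank1 (fun n : 'I_N => (damp C n)%:C * U j n)) <= 1.
    by rewrite -(sum_normsq_row j); exact: bessel.
  apply: (@le_trans _ _ (lam j - a *
      kernel_form (expw e) (rank1 (fun n : 'I_N => (damp C n)%:C * U j n)))).
    by rewrite lerD2l lerN2 ler_piMr.
  rewrite eigenvalueE !kernel_formE// mulrCA [a / d * _]mulrCA -mulrBr -mulrDr.
  rewrite ler_wpM2l// -intRZ ?iq// -intRZ ?iq// -intRB ?integrableRZ ?iq//.
  rewrite -intRD ?integrableRZ ?iq//.
  apply: le_intR; [by apply: integrableRB; rewrite ?integrableRZ ?iq|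
    by apply: integrableRD; rewrite ?integrableRZ ?iq|move=> t].
  rewrite !wave_form_rank1; set w := expw e t.
  (* Coefficients of the eigenvector [j] along v_t: [X] and [X1] are full, [Y] is damped, [Z] is
     what damping removes. *)
  set X := \sum_n _; set Y := \sum_n _; set X1 := \sum_n _; set Z := \sum_n _.
  have -> : X1 = X by apply: eq_bigr => n _; rewrite mul1r.
  have XE : X = Y + Z.
    rewrite -big_split/=; apply: eq_bigr => n _.
    by rewrite -mulrDl /cz rmorphB/= -mulrDl addrC subrK mul1r.
  have h := normsqD_ge Y Z d0 d1; rewrite -XE in h.
  have aw : 0 <= a * w by rewrite mulr_ge0// expw_ge0.
  have h1 := ler_wpM2l aw h.
  have h2 : psi t * normsq X <= Num.max (psi t) 0 * normsq X.
    by rewrite ler_wpM2r ?normsq_ge0// le_max lexx.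
  apply: (@le_trans _ _ (psi t * normsq X + a / d * (w * normsq Z))).
    rewrite /psi -/w; move: (d^-1) h1 => d' h1; lra.
  by rewrite lerD2r.
apply: le_trans (ler_sum _ (fun j _ => main j)) _.
rewrite big_split/= -mulr_sumr.
rewrite (sum_kernel_form (fun=> 1))// (sum_kernel_form (fun n => 1 - damp C n))//.
apply: lerD.
  rewrite mulrC le_eqVlt -sum_inv_ord; apply/orP; left; apply/eqP.
  by congr (_ * _); apply: eq_bigr => n _; rewrite expr1n mul1r.
rewrite intR_expw// ler_wpM2l ?divr_ge0 ?(ltW d0)//.
rewrite ler_wpM2l//; first by rewrite mulr_ge0// divr_ge0// ltW.
have /(ler_wpM2l (sqr_ge0 C)) := @sum_invsq_le R N.
rewrite [C ^+ 2 * 2]mulrC; apply: le_trans.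
rewrite big_mkord mulr_sumr; apply: ler_sum => n _.
have v0 : 0 <= n.+1%:R^-1 :> R by rewrite invr_ge0.
have v1 : n.+1%:R^-1 <= 1 :> R by rewrite invf_le1// ler1n.
have rho := damp_ge n C0; have r1 := damp_le1 n C0.
(* The factor 1/n is discarded, since the bound C^2/n^2 for the square is summable by itself. *)
rewrite -exprVn -exprMn; apply: (@le_trans _ _ ((1 - damp C n) ^+ 2)).
  by rewrite ler_piMr ?sqr_ge0.
rewrite lerXn2r ?nnegrE ?subr_ge0 ?mulr_ge0//.
by rewrite lerBlDr -lerBlDl.
Qed.

End SpectralSums.

(** * Continuous test functions for the lower bound *)

Section TestFunction.
Context {R : realType}.
Variables (phi : R -> R) (a : R).
Hypotheses (phi_int : integrableR phi) (a0 : 0 <= a).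

Definition ramp (b x : R) : R := Num.max (x - b) 0.

Lemma ramp_ge0 b x : 0 <= ramp b x. Proof. by rewrite le_max lexx orbT. Qed.

Lemma ramp_le_norm b x : 0 <= b -> ramp b x <= `|x|.
Proof. by move=> b0; rewrite ge_max normr_ge0 andbT lerBlDr (le_trans (ler_norm x))// lerDl. Qed.

Lemma measurable_ramp b (f : R -> R) : measurable_fun [set: R] f ->
  measurable_fun [set: R] (fun t => ramp b (f t)).
Proof.
move=> mf; apply: measurable_maxr; last exact: measurable_cst.
by apply: measurable_funB => //; exact: measurable_cst.
Qed.

Lemma integrable_ramp b (f : R -> R) : 0 <= b -> integrableR f ->
  integrableR (fun t => ramp b (f t)).
Proof.
move=> b0 fi; apply: le_integrableR (integrable_norm fi) => //.
  by apply: measurable_ramp; exact: integrableR_measurable.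
by move=> t; rewrite ger0_norm ?ramp_ge0// ramp_le_norm.
Qed.

Definition clamp01 (x : R) : R := Num.min 1 (Num.max 0 x).

Lemma clamp01_ge0 x : 0 <= clamp01 x.
Proof. by rewrite le_min ler01 le_max lexx. Qed.

Lemma clamp01_le1 x : clamp01 x <= 1.
Proof. by rewrite ge_min lexx. Qed.

Lemma clamp01_le0 x : x <= 0 -> clamp01 x = 0.
Proof. by move=> x0; rewrite /clamp01 (max_idPl x0) min_r. Qed.

Lemma clamp01_ge1 x : 1 <= x -> clamp01 x = 1.
Proof. by move=> x1; rewrite /clamp01 max_r ?(le_trans ler01)// min_l. Qed.

Lemma continuous_clamp01 (f : R -> R) : continuous f ->
  continuous (fun t => clamp01 (f t)).
Proof.
move=> cf t; apply: (@continuous_min _ _ (fun=> 1) (fun t => Num.max 0 (f t))).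
  exact: cst_continuous.
by apply: (@continuous_max _ _ (fun=> 0) f); [exact: cst_continuous|exact: cf].
Qed.

(** With x a value of phi and y one of a continuous approximation, the clamp replaces the indicator
    of phi > a. Its transition zone costs at most 1/m; the minimum with the ramp keeps this cost
    integrable over the line. *)
Lemma ramp_clamp_ge (m x y : R) : 0 < m ->
  ramp a x - `|x - y| - Num.min m^-1 (ramp a x) <= (x - a) * clamp01 ((y - a) * m).
Proof.
move=> m0; have c0 := clamp01_ge0 ((y - a) * m); have c1 := clamp01_le1 ((y - a) * m).
have xy1 := ler_norm (x - y); have xy2 := ler_norm (y - x); rewrite distrC in xy2.
have [xa|ax] := leP x a.
  have r0 : ramp a x = 0 by rewrite /ramp max_r// subr_le0.
  rewrite r0 (min_idPr _) ?invr_ge0 ?(ltW m0)// subr0 sub0r.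
  have [ya|ay] := leP y a.
    rewrite clamp01_le0; first by rewrite mulr0 oppr_le0.
    by rewrite pmulr_lle0// subr_le0.
  have : (a - x) * clamp01 ((y - a) * m) <= a - x by rewrite ler_piMr// subr_ge0.
  move=> h; lra.
have r0 : ramp a x = x - a by rewrite /ramp max_l// subr_ge0 ltW.
rewrite r0; have [ym|ym] := leP m^-1 (y - a).
  rewrite clamp01_ge1; last by rewrite -ler_pdivrMr// mul1r.
  rewrite mulr1; have : 0 <= Num.min m^-1 (x - a).
    by rewrite le_min invr_ge0 ltW//= subr_ge0 ltW.
  move=> h; have := normr_ge0 (x - y) => h'; lra.
have : 0 <= (x - a) * clamp01 ((y - a) * m) by rewrite mulr_ge0// subr_ge0 ltW.
by case: (leP m^-1 (x - a)) => h1 h2; lra.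
Qed.

Lemma invS_cvg0 : (k.+1%:R^-1 : R) @[k --> \oo] --> (0 : R).
Proof. exact: cvg_harmonic. Qed.

Lemma expw_invS_cvg1 t : expw k.+1%:R^-1 t @[k --> \oo] --> (1 : R).
Proof.
rewrite -[X in _ --> X](_ : expR (- (0 * `|t|)) = 1); last by rewrite mul0r oppr0 expR0.
apply: (cvg_comp (fun k : nat => - (k.+1%:R^-1 * `|t|)) expR).
  by apply: cvgN; apply: cvgM; [exact: invS_cvg0|exact: cvg_cst].
exact: continuous_expR.
Qed.

(** Confines the test function to a compact interval, on which a continuous function approximates
    phi in mean. *)
Let cut (k : nat) (t : R) := clamp01 (k.+1%:R - `|t|).

Let cut_cvg1 t : cut k t @[k --> \oo] --> (1 : R).
Proof.
apply: cvg_near_cst; near=> k; rewrite /cut clamp01_ge1// lerBrDr.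
rewrite -natr1 addrC lerD2r; near: k; exact: nbhs_infty_ger.
Unshelve. all: by end_near. Qed.

Let continuous_cut k : continuous (cut k).
Proof.
apply: continuous_clamp01; apply: continuousD_fun; first exact: continuous_cst_fun.
by apply: continuousN_fun => t; exact: norm_continuous.
Qed.

(** Continuity of [chi] is for the pointwise limit of [smoothed], the exponential bound for Bessel's
    inequality. The thirds of [d] pay for the weight [w], the transition zone of the clamp and the
    approximation of phi. *)
Lemma exists_test_function (d : R) : 0 < d -> exists e : R, exists chi : R -> R,
  [/\ 0 < e, continuous chi, forall t, 0 <= chi t, forall t, chi t <= expw e t &
      intR (fun t => ramp a (phi t)) - d <=
      intR (fun t => phi t * chi t) - a * intR chi].
Proof.
move=> d0; have iramp := integrable_ramp a0 phi_int.
have mphi := integrableR_measurable phi_int.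
have d30 : 0 < d / 3 by rewrite divr_gt0.
pose w k t := cut k t * expw k.+1%:R^-1 t.
have w0 k t : 0 <= w k t by rewrite mulr_ge0 ?clamp01_ge0 ?expw_ge0.
have cw k : continuous (w k).
  by apply: continuousM_fun; [exact: continuous_cut|exact: continuous_expw].
have kexp k t : expw k.+1%:R^-1 t <= 1 :> R by rewrite expw_le1// invr_ge0.
have w1 k t : w k t <= 1 by rewrite mulr_ile1 ?clamp01_ge0 ?expw_ge0 ?clamp01_le1.
have lim1 : intR (fun t => ramp a (phi t) * w k t) @[k --> \oo] -->
    intR (fun t => ramp a (phi t)).
  apply: (intR_cvg (h := fun t => ramp a (phi t))) => //.
  - move=> k; apply: measurable_funM; first exact: measurable_ramp.
    exact: continuous_measurable_fun.
  - move=> k t; rewrite ger0_norm; last by rewrite mulr_ge0 ?ramp_ge0.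
    by rewrite ler_piMr ?ramp_ge0.
  - move=> t; rewrite -[X in _ --> X]mulr1; apply: cvgM; first exact: cvg_cst.
    rewrite -[X in _ --> X]mulr1; apply: cvgM; [exact: cut_cvg1|exact: expw_invS_cvg1].
have imin k : integrableR (fun t => Num.min k.+1%:R^-1 (ramp a (phi t))).
  apply: le_integrableR iramp.
    by apply: measurable_minr; [exact: measurable_cst|exact: measurable_ramp].
  move=> t; rewrite ger0_norm ?ge_min ?lexx ?orbT//.
  by rewrite le_min invr_ge0 ler0n ramp_ge0.
have lim2 : intR (fun t => Num.min k.+1%:R^-1 (ramp a (phi t))) @[k --> \oo] --> (0 : R).
  rewrite -[X in _ --> X](@intR0 R).
  apply: (intR_cvg (h := fun t => ramp a (phi t))) => //.
  - by move=> k; exact: integrableR_measurable.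
  - move=> k t; rewrite ger0_norm ?ge_min ?lexx ?orbT//.
    by rewrite le_min invr_ge0 ler0n ramp_ge0.
  - move=> t; apply: (squeeze_cvgr _ (cvg_cst 0) invS_cvg0).
    by apply: nearW => k; rewrite le_min invr_ge0 ler0n ramp_ge0 ge_min lexx.
have [k [hk1 hk2]] : exists k, intR (fun t => ramp a (phi t)) - d / 3 <=
    intR (fun t => ramp a (phi t) * w k t) /\
    intR (fun t => Num.min k.+1%:R^-1 (ramp a (phi t))) <= d / 3.
  have /cvgrPdist_le /(_ _ d30) [n1 _ h1] := lim1.
  have /cvgrPdist_le /(_ _ d30) [n2 _ h2] := lim2.
  exists (maxn n1 n2); split.
    by have := h1 _ (leq_maxl n1 n2) => /(le_trans (ler_norm _)) h; lra.
  have := h2 _ (leq_maxr n1 n2); rewrite /= distrC subr0.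
  by move=> /(le_trans (ler_norm _)).
pose E : set R := `[- k.+1%:R, k.+1%:R]%classic.
have mE : measurable E by exact: measurable_itv.
have phiE : lebesgue_measure.-integrable E (EFin \o phi).
  exact: integrableS phi_int.
have Efin : (lebesgue_measure E < +oo)%E.
  by rewrite /E lebesgue_measure_itv/=; case: ifP => _; rewrite ?ltry// -EFinD ltry.
have [g_ [cg ig gphi]] := approximation_continuous_integrable mE Efin phiE.
have /fine_cvgP[_] := gphi; move=> /cvgrPdist_le /(_ _ d30)[n _ /(_ n (leqnn n))].
rewrite /= sub0r normrN => /(le_trans (ler_norm _)) hn.
have {ig} ign := ig n; have {cg} cgn := cg n; move: (g_ n) ign cgn hn => psi ipsi cpsi hn.
(* Restricted to [E], since [psi] is uncontrolled outside, where the factor [w] vanishes. *)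
pose h := (fun t => `|phi t - psi t|) \_ E.
have ih : integrableR h.
  have -> : EFin \o h = (EFin \o (fun t => `|phi t - psi t|)) \_ E.
    by apply/funext => t; rewrite /= /h /patch; case: ifP.
  apply: (proj1 (integrable_mkcond _ _)); first exact: mE.
  by apply: integrable_norm; exact: (integrableB _ phiE ipsi).
have hint : intR h <= d / 3 by apply: le_trans hn; rewrite /h -Rintegral_mkcond.
pose chi t := clamp01 ((psi t - a) * k.+1%:R) * w k t.
have cchi : continuous chi.
  apply: continuousM_fun => //; apply: continuous_clamp01.
  apply: continuousM_fun; last exact: continuous_cst_fun.
  by apply: continuousD_fun => //; exact: continuous_cst_fun.
have chi0 t : 0 <= chi t by rewrite mulr_ge0 ?clamp01_ge0.
have chiw t : chi t <= expw k.+1%:R^-1 t.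
  rewrite /chi /w mulrA ler_piMl ?expw_ge0//.
  by rewrite mulr_ile1 ?clamp01_ge0 ?clamp01_le1.
have k0 : 0 < k.+1%:R^-1 :> R by rewrite invr_gt0.
have ichi : integrableR chi.
  apply: le_integrableR (integrable_expw k0); first exact: continuous_measurable_fun.
  by move=> t; rewrite ger0_norm.
exists k.+1%:R^-1, chi; split => //.
have iphichi : integrableR (fun t => phi t * chi t).
  apply: (@integrableRM _ _ _ 1) => //; first exact: continuous_measurable_fun.
  by move=> t; rewrite ger0_norm// (le_trans (chiw t)).
have irw : integrableR (fun t => ramp a (phi t) * w k t).
  apply: (@integrableRM _ _ _ 1) => //; first exact: continuous_measurable_fun.
  by move=> t; rewrite ger0_norm.
have iac := integrableRZ a ichi.
rewrite -intRZ// -intRB//.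
apply: (@le_trans _ _ (intR (fun t => ramp a (phi t) * w k t) - intR h
   - intR (fun t => Num.min k.+1%:R^-1 (ramp a (phi t))))); first by lra.
rewrite -intRB// -intRB//; last exact: integrableRB.
apply: le_intR; [by apply: integrableRB => //; exact: integrableRB|exact: integrableRB|].
move=> t.
have wh : `|phi t - psi t| * w k t <= h t.
  rewrite /h /patch; case: ifPn => tE; first by rewrite ler_piMr.
  suff -> : w k t = 0 by rewrite mulr0.
  rewrite /w /cut clamp01_le0 ?mul0r// subr_le0 leNgt; apply: contra tE => tk.
  by apply/mem_set; rewrite /E/= in_itv/= -ler_norml ltW.
have wm : Num.min k.+1%:R^-1 (ramp a (phi t)) * w k t <=
    Num.min k.+1%:R^-1 (ramp a (phi t)).
  by rewrite ler_piMr// le_min ltW//= ramp_ge0.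
have k1 : 0 < k.+1%:R :> R by rewrite ltr0n.
have := ler_wpM2r (w0 k t) (ramp_clamp_ge (phi t) (psi t) k1).
rewrite /chi !mulrBl => hh; lra.
Qed.

End TestFunction.

(** * Limits of the traces of ramps *)

Section RampLimit.
Context {R : realType}.

Lemma harm_cvg : harm N @[N --> \oo] --> (+oo : set_system R).
Proof.
apply/cvgryPge => A; near=> N; apply: le_trans (harm_ge N).
have -> : A = ln (expR A) by rewrite expRK.
rewrite ler_ln ?posrE ?expR_gt0//.
apply: (@le_trans _ _ N%:R); last by rewrite ler_nat.
by near: N; exact: nbhs_infty_ger.
Unshelve. all: by end_near. Qed.

Lemma harm_gt0 N : (0 < N)%N -> 0 < harm N :> R.
Proof.
case: N => // N _; rewrite /harm big_nat_recr//= ltr_wpDl//.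
exact: harm_ge0.
Qed.

Lemma le_harm M N : (M <= N)%N -> harm M <= harm N :> R.
Proof.
move=> MN; rewrite [leRHS](big_cat_nat (n := M))//= lerDl.
by apply: sumr_ge0 => i _; rewrite invr_ge0.
Qed.

Lemma harm_ratio_cvg (x : nat -> R) (l : R) :
  (forall d, 0 < d -> exists K, forall N, `|x N - l * harm N| <= d * harm N + K) ->
  (harm N)^-1 * x N @[N --> \oo] --> l.
Proof.
move=> h; apply/cvgrPdist_le => d d0.
have d20 : 0 < d / 2 by rewrite divr_gt0.
have [K hK] := h _ d20; near=> N.
have HK : 2 * K / d <= harm N.
  by near: N; have /cvgryPge := harm_cvg; apply.
have H0 : 0 < harm N :> R by apply: harm_gt0; near: N; exact: nbhs_infty_gt.
have -> : l - (harm N)^-1 * x N = - ((x N - l * harm N) / harm N).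
  by field; rewrite gt_eqF.
rewrite normrN normrM normfV (gtr0_norm H0) ler_pdivrMr//.
apply: le_trans (hK N) _; move: HK; rewrite ler_pdivrMr// => HK; lra.
Unshelve. all: by end_near. Qed.

(** A predicate, so that it passes to -phi with the same [U] and negated eigenvalues; the
    diagonalization that [spectralmx] selects for the negated matrix need not be this one. *)
Definition eigensystem N (phi : R -> R) (U : 'M[R[i]]_N) (lam : 'I_N -> R) :=
  [/\ forall j k, \sum_n U j n * (U k n)^*%C = (j == k)%:R,
      forall n m, \sum_j U j n * (U j m)^*%C = (n == m)%:R &
      forall n m, Kmx phi N n m = \sum_j (lam j)%:C * ((U j n)^*%C * U j m)].

Lemma spectral_eigensystem N (phi : R -> R) : eigensystem phi
  (spectralmx (Kmx phi N)) (fun j => complex.Re (spectral_diag (Kmx phi N) 0 j)).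
Proof.
have conjE (z : R[i]) : Num.conj z = z^*%C by [].
set K := Kmx phi N; set U := spectralmx K.
have Uu : U \is unitarymx := spectral_unitarymx K.
have UV := elimT unitarymxP Uu.
have VU : (map_mx Num.conj U^T) *m U = 1%:M.
  by rewrite -(invmx_unitary Uu) mulVmx// unitarymx_unit.
split=> [j k|n m|n m].
- have := congr1 (fun M : 'M[R[i]]_N => M j k) UV; rewrite !mxE => <-.
  by apply: eq_bigr => n _; rewrite !mxE conjE.
- have := congr1 (fun M : 'M[R[i]]_N => M m n) VU; rewrite !mxE eq_sym => <-.
  by apply: eq_bigr => j _; rewrite !mxE conjE mulrC.
- have Kh : K \is hermsymmx := Kmx_herm phi N.
  have /hermitian_normalmx/orthomx_spectralP KE := Kh.
  rewrite -/K [in LHS]KE -/U invmx_unitary// mul_mx_diag mxE.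
  apply: eq_bigr => j _; rewrite !mxE conjE.
  have Dr : spectral_diag K 0 j \is Num.real.
    by have /mxOverP := hermitian_spectral_diag_real Kh; apply.
  by rewrite RRe_real//; ring.
Qed.

Lemma KmxN N (phi : R -> R) : Kmx (fun t => - phi t) N = - Kmx phi N.
Proof.
apply/matrixP => n m; rewrite !mxE -mulrN -mulrN; congr (_ * (_ * _)).
rewrite /cintegral /=; apply/eqP; rewrite eq_complex/= -!intRN; apply/andP; split.
  by apply/eqP; apply: eq_intR => t; rewrite /=; ring.
by apply/eqP; apply: eq_intR => t; rewrite /=; ring.
Qed.

Lemma eigensystemN N (phi : R -> R) (U : 'M[R[i]]_N) (lam : 'I_N -> R) :
  eigensystem phi U lam -> eigensystem (fun t => - phi t) U (fun j => - lam j).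
Proof.
move=> [h1 h2 h3]; split=> // n m; rewrite KmxN mxE h3 -sumrN.
by apply: eq_bigr => j _; rewrite rmorphN mulNr.
Qed.

Section Limit.
Variables (phi : R -> R) (a : R).
Variables (U : forall N, 'M[R[i]]_N) (lam : forall N, 'I_N -> R).
Hypotheses (phi_int : integrableR phi) (a0 : 0 <= a).
Hypothesis (sys : forall N, eigensystem phi (U N) (@lam N)).

Let L : R := (2 * pi)^-1 * intR (fun t => ramp a (phi t)).

Let pi2_gt0 : 0 < (2 * pi)^-1 :> R.
Proof. by rewrite invr_gt0 mulr_gt0 ?pi_gt0. Qed.

Let upper d : 0 < d -> exists K, forall N,
  \sum_(j < N) ramp a (lam j) <= (L + d) * harm N + K.
Proof.
move=> d0.
(* One sequence serves as the rate of the exponential weight and as the loss [d] of [sum_ramp_le]: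
   both must vanish for the threshold (1 - u) a e^(-u|t|) to tend to a. *)
pose u k : R := k.+1%:R^-1.
have lim : intR (fun t => ramp 0 (phi t - (1 - u k) * a * expw (u k) t))
    @[k --> \oo] --> intR (fun t => ramp a (phi t)).
  have u0 k : 0 <= u k by rewrite invr_ge0.
  have u1 k : u k <= 1 by rewrite invf_le1// ler1n.
  apply: (intR_cvg (h := fun t => `|phi t|)).
  - move=> k; apply: measurable_ramp; apply: measurable_funB.
      exact: integrableR_measurable.
    by apply: measurable_funM; [exact: measurable_cst|exact: measurable_expw].
  - exact: integrable_norm.
  - move=> k t; rewrite ger0_norm ?ramp_ge0// /ramp subr0 ge_max normr_ge0 andbT.
    rewrite lerBlDr (le_trans (ler_norm _))// lerDl.
    by rewrite !mulr_ge0 ?expw_ge0 ?subr_ge0.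
  - move=> t; have -> : ramp a (phi t) = ramp 0 (phi t - a).
      by rewrite /ramp subr0.
    apply: (@cvg_comp _ _ _ _ (ramp 0) _ (nbhs (phi t - a))).
      apply: cvgB; first exact: cvg_cst.
      rewrite -[X in _ --> X](_ : (1 - 0) * a * 1 = a); last by rewrite subr0 mul1r mulr1.
      apply: cvgM; last exact: expw_invS_cvg1.
      apply: cvgM; last exact: cvg_cst.
      by apply: cvgB; [exact: cvg_cst|exact: invS_cvg0].
    apply: (@continuous_max _ _ (fun x => x - 0) (fun=> 0)); last exact: cst_continuous.
    by apply: continuousB; [exact: id|exact: cst_continuous].
have d20 : 0 < d * (2 * pi) by rewrite mulr_gt0// -invr_gt0.
have /cvgrPdist_le /(_ _ d20) [k _ /(_ k (leqnn k))] := lim.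
rewrite distrC => /(le_trans (ler_norm _)) hk.
have u0 : 0 < u k by rewrite invr_gt0.
have u1 : u k <= 1 by rewrite invf_le1// ler1n.
have eC : poisson (u k) 0 + 2^-1 <= poisson (u k) 0 + 2^-1 by [].
exists (a / u k * ((2 * pi)^-1 * (2 / u k) * (2 * (poisson (u k) 0 + 2^-1) ^+ 2))).
move=> N; have [h1 h2 h3] := sys N.
apply: le_trans (sum_ramp_le phi_int h1 h2 h3 a0 u0 eC u0 u1) _.
rewrite lerD2r mulrC ler_wpM2r ?harm_ge0// /L -lerBlDl -mulrBr.
rewrite ler_pdivrMl ?mulr_gt0 ?pi_gt0// [leRHS]mulrC; apply: le_trans hk.
rewrite lerD2r le_eqVlt; apply/orP; left; apply/eqP.
by apply: eq_intR => t; rewrite /ramp subr0.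
Qed.

Let lower d : 0 < d -> exists K, forall N,
  (L - d) * harm N - K <= \sum_(j < N) ramp a (lam j).
Proof.
move=> d0.
have d20 : 0 < d / 2 * (2 * pi) by rewrite mulr_gt0 ?divr_gt0// -invr_gt0.
have [e [chi [e0 cchi chi0 chiw hchi]]] := exists_test_function phi_int a0 d20.
pose C := poisson e 0 + 2^-1; have eC : poisson e 0 + 2^-1 <= C by [].
(* Dominated by |phi|, as [smoothed] lies between 0 and H_N. *)
have lim : intR (fun s => phi s * ((harm N)^-1 * smoothed C chi N s))
    @[N --> \oo] --> intR (fun s => phi s * chi s).
  apply: (intR_cvg (h := fun t => `|phi t|)).
  - move=> N.
    have := integrableR_measurable (integrableRZ (harm N)^-1
      (@integrable_smoothed R N phi phi_int C chi)).
    by congr measurable_fun; apply/funext => s; rewrite mulrCA.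
  - exact: integrable_norm.
  - move=> N s; rewrite normrM ler_piMr//.
    have S0 := smoothed_ge0 C e0 cchi chi0 chiw N s.
    have S1 := smoothed_le e0 eC cchi chi0 chiw N s.
    rewrite ger0_norm ?mulr_ge0 ?invr_ge0 ?harm_ge0//.
    (* For [N = 0] the harmonic number is 0, and so is its inverse by convention. *)
    have [H0|H0] := eqVneq (harm N : R) 0; first by rewrite H0 invr0 mul0r.
    by rewrite mulrC ler_pdivrMr ?mul1r// lt_def H0 harm_ge0.
  - move=> s; apply: cvgM; first exact: cvg_cst.
    by apply: harm_ratio_cvg => d1 d10; exact: (smoothed_cvg e0 eC cchi chi0 chiw s d10).
have /cvgrPdist_le /(_ _ d20) [N0 _ hN] := lim.
(* The limit is effective from [N0] on; below it, this constant makes the left side nonpositive. *)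
exists (`|L - d| * harm N0) => N.
have H0 := @harm_ge0 R N.
have S0 : 0 <= \sum_(j < N) ramp a (lam j) by apply: sumr_ge0 => j _; exact: ramp_ge0.
have [NN0|N0N] := ltnP N N0.
  apply: le_trans S0; rewrite subr_le0.
  apply: (@le_trans _ _ (`|L - d| * harm N)); first by rewrite ler_wpM2r// ler_norm.
  by rewrite ler_wpM2l// le_harm// ltnW.
have NL : (L - d) * harm N <= \sum_(j < N) ramp a (lam j).
  have [h1 h2 h3] := sys N.
  apply: le_trans (sum_ramp_ge phi_int h1 h2 h3 e0 eC cchi chi0 chiw a0).
  have hI : intR (fun s => phi s * chi s) -
      intR (fun s => phi s * ((harm N)^-1 * smoothed C chi N s)) <= d / 2 * (2 * pi).
    by have := hN N N0N => /(le_trans (ler_norm _)).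
  have -> : intR (fun s => phi s * smoothed C chi N s) =
      harm N * intR (fun s => phi s * ((harm N)^-1 * smoothed C chi N s)).
    rewrite -intRZ; last first.
      apply: eq_integrableR (integrableRZ (harm N)^-1
        (@integrable_smoothed R N phi phi_int C chi)) => s.
      by rewrite mulrCA.
    apply: eq_intR => s; rewrite mulrCA; congr (_ * _).
    have [HN0|HN0] := eqVneq (harm N : R) 0; last by rewrite mulVKf.
    rewrite HN0 mul0r; apply/eqP; rewrite eq_le (smoothed_ge0 C e0 cchi chi0 chiw) andbT.
    by rewrite -[leRHS]HN0 (smoothed_le e0 eC cchi chi0 chiw).
  move: hI; set I := intR (fun s => phi s * ((harm N)^-1 * _)) => hI.
  have pi0 : 0 < 2 * pi :> R by rewrite mulr_gt0 ?pi_gt0.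
  have -> : (L - d) * harm N = (2 * pi)^-1 * harm N *
      (intR (fun t => ramp a (phi t)) - d * (2 * pi)).
    rewrite /L; move: (2 * pi) pi0 => p p0; field; rewrite gt_eqF//.
  have -> : (2 * pi)^-1 * (harm N * I) - a * harm N * ((2 * pi)^-1 * intR chi) =
    (2 * pi)^-1 * harm N * (I - a * intR chi) by ring.
  rewrite ler_wpM2l ?mulr_ge0// ?(ltW pi2_gt0)//.
  move: (2 * pi) hI hchi => p hI hchi; lra.
by apply: le_trans NL; rewrite lerBlDr lerDl mulr_ge0 ?harm_ge0.
Qed.

Lemma ramp_sum_cvg :
  (harm N)^-1 * (\sum_(j < N) ramp a (lam j)) @[N --> \oo] --> L.
Proof.
apply: harm_ratio_cvg => d d0; have [K1 h1] := upper d0; have [K2 h2] := lower d0.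
exists (`|K1| + `|K2|) => N; have := h1 N; have := h2 N.
have := ler_norm K1; have := ler_norm K2; have := normr_ge0 K1; have := normr_ge0 K2.
move=> g1 g2 g3 g4 g5 g6; rewrite ler_norml; apply/andP; split; lra.
Qed.

End Limit.
End RampLimit.

(** * Traces of Lipschitz functions *)

Section LipschitzFunctions.
Context {R : realType}.

Section PiecewiseLinear.
Variables (f : R -> R) (L h : R).
Hypotheses (f0 : f 0 = 0) (f_lip : forall x y, `|f x - f y| <= L * `|x - y|).
Hypotheses (h0 : 0 < h).

(** A difference of neighbouring ramps grows on one cell only, so for f(0) = 0 this is linear
    interpolation at the nodes i h, constant beyond K h and zero on the negative axis. *)
Definition interpolant (K : nat) (x : R) : R :=
  \sum_(i < K) (f (i.+1%:R * h) - f (i%:R * h)) / h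
    * (ramp (i%:R * h) x - ramp (i.+1%:R * h) x).

(** For x >= 0 the first difference is min(x, h). The simpler constant bound 2 L h would not be
    integrable along phi. *)
Definition interpolation_error (M : R) (x : R) : R :=
  2 * L * (ramp 0 x - ramp h x) + L * ramp M x.

Let L0 : 0 <= L.
Proof.
by have := f_lip 1 0; rewrite subr0 normr1 mulr1; exact: le_trans (normr_ge0 _).
Qed.

Lemma rampE0 (b x : R) : x <= b -> ramp b x = 0.
Proof. by move=> xb; rewrite /ramp max_r// subr_le0. Qed.

Lemma rampE (b x : R) : b <= x -> ramp b x = x - b.
Proof. by move=> bx; rewrite /ramp max_l// subr_ge0. Qed.

Lemma interpolant_le0 K x : x <= 0 -> interpolant K x = 0.
Proof.
move=> x0; rewrite /interpolant big1// => i _.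
by rewrite !rampE0 ?subrr ?mulr0// (le_trans x0)// mulr_ge0// ltW.
Qed.

Lemma interpolation_error_ge0 M x : 0 <= interpolation_error M x.
Proof.
rewrite addr_ge0 ?mulr_ge0 ?ramp_ge0// subr_ge0 /ramp ge_max !le_max lexx orbT andbT.
by rewrite subr0 gerBl ltW.
Qed.

Let interpolant_above K x : K%:R * h <= x -> interpolant K x = f (K%:R * h).
Proof.
elim: K => [|K IH] Kx; first by rewrite /interpolant big_ord0 mul0r f0.
have Kx' : K%:R * h <= x by apply: le_trans Kx; rewrite ler_wpM2r ?(ltW h0)// ler_nat.
rewrite /interpolant big_ord_recr/= -/(interpolant K x) IH// !rampE//.
have E : K.+1%:R = K%:R + 1 :> R by rewrite -natr1.
have -> : x - K%:R * h - (x - K.+1%:R * h) = h by rewrite E; ring.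
by rewrite divfK ?gt_eqF// addrC subrK.
Qed.

Let interpolant_below K x : 0 <= x -> x <= K%:R * h ->
  `|f x - interpolant K x| <= 2 * L * (x - ramp h x).
Proof.
move=> x0; elim: K => [|K IH] xK.
  have -> : x = 0 by apply/eqP; rewrite eq_le x0 andbT -(mul0r h).
  by rewrite f0 interpolant_le0// (rampE0 (ltW h0)) !subrr normr0 mulr0.
rewrite /interpolant big_ord_recr/= -/(interpolant K x) (rampE0 xK) subr0.
have [xK'|Kx] := leP x (K%:R * h); first by rewrite rampE0// mulr0 addr0 IH.
rewrite (interpolant_above (ltW Kx)) (rampE (ltW Kx)).
set s := (f _ - f _) / h; set z := K%:R * h in Kx *.
have sL : `|s| <= L.
  rewrite normrM normfV (gtr0_norm h0) ler_pdivrMr//.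
  apply: le_trans (f_lip _ _) _; rewrite -mulrBl -natr1 addrAC subrr add0r mul1r.
  by rewrite (gtr0_norm h0).
have xz : 0 <= x - z by rewrite subr_ge0 ltW.
have h1 : `|f x - f z| <= L * (x - z) by rewrite -[in leRHS](ger0_norm xz) f_lip.
have h2 : `|s * (x - z)| <= L * (x - z) by rewrite normrM (ger0_norm xz) ler_wpM2r.
(* As z >= 0 and x <= z + h, the distance to the last node is at most min(x, h). *)
have h3 : x - z <= x - ramp h x.
  rewrite lerD2l lerN2 /ramp ge_max mulr_ge0 ?(ltW h0)// andbT.
  have e1 : K.+1%:R * h = z + h by rewrite -natr1 mulrDl mul1r.
  by rewrite lerBlDr -e1.
have h4 := ler_wpM2l L0 h3.
have -> : f x - (f z + s * (x - z)) = (f x - f z) - s * (x - z) by ring.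
apply: le_trans (ler_normB _ _) _; lra.
Qed.

Lemma interpolantP K x : 0 <= x ->
  `|f x - interpolant K x| <= interpolation_error (K%:R * h) x.
Proof.
move=> x0; rewrite /interpolation_error (rampE x0) subr0.
have [xK|Kx] := leP x (K%:R * h).
  by rewrite (rampE0 xK) mulr0 addr0 interpolant_below.
rewrite (interpolant_above (ltW Kx)).
apply: (@le_trans _ _ (L * ramp (K%:R * h) x)).
  by rewrite (rampE (ltW Kx)) -[in leRHS](@ger0_norm _ (x - _)) ?f_lip// subr_ge0 ltW.
rewrite lerDr mulr_ge0 ?mulr_ge0// subr_ge0 /ramp ge_max x0 andbT gerBl ltW//.
Qed.

End PiecewiseLinear.

Section TraceLimit.
Variables (phi : R -> R) (lam : forall N, 'I_N -> R).
Variables (U : forall N, 'M[R[i]]_N).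
Hypotheses (phi_int : integrableR phi).
Hypothesis (sys : forall N, eigensystem phi (U N) (@lam N)).

(** Integrability is included so that the property is stable under linear combinations. *)
Definition trace_limit (f : R -> R) : Prop :=
  integrableR (fun t => f (phi t)) /\
  ((harm N)^-1 * (\sum_(j < N) f (lam j)) @[N --> \oo] -->
    (2 * pi)^-1 * intR (fun t => f (phi t))).

Lemma trace_limit_ramp b : 0 <= b -> trace_limit (ramp b).
Proof.
by move=> b0; split; [exact: integrable_ramp|exact: (ramp_sum_cvg phi_int b0 sys)].
Qed.

Lemma trace_limit_rampN b : 0 <= b -> trace_limit (fun x => ramp b (- x)).
Proof.
move=> b0; have phiN := integrableRN phi_int; split; first exact: integrable_ramp.
exact: (ramp_sum_cvg phiN b0 (fun N => eigensystemN (sys N))).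
Qed.

Lemma trace_limitD f k : trace_limit f -> trace_limit k ->
  trace_limit (fun x => f x + k x).
Proof.
move=> [fi fc] [ki kc]; split; first exact: integrableRD.
rewrite intRD// mulrDr; under eq_fun do rewrite big_split/= mulrDr.
exact: cvgD.
Qed.

Lemma trace_limitZ c f : trace_limit f -> trace_limit (fun x => c * f x).
Proof.
move=> [fi fc]; split; first exact: integrableRZ.
rewrite intRZ// mulrCA; under eq_fun do rewrite -mulr_sumr mulrCA.
by apply: cvgM => //; exact: cvg_cst.
Qed.

Lemma trace_limitB f k : trace_limit f -> trace_limit k ->
  trace_limit (fun x => f x - k x).
Proof.
move=> fl kl; have := trace_limitD fl (trace_limitZ (-1) kl).
by congr trace_limit; apply/funext => x; rewrite mulN1r.
Qed.

Lemma trace_limit_sum (I : Type) (s : seq I) (F : I -> R -> R) :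
  (forall i, trace_limit (F i)) -> trace_limit (fun x => \sum_(i <- s) F i x).
Proof.
move=> Fl; elim: s => [|i s IH].
  have := trace_limitZ 0 (trace_limit_ramp (lexx 0)).
  by congr trace_limit; apply/funext => x; rewrite mul0r big_nil.
have := trace_limitD (Fl i) IH.
by congr trace_limit; apply/funext => x; rewrite big_cons.
Qed.

Lemma trace_limit_approx f : integrableR (fun t => f (phi t)) ->
  (forall d, 0 < d -> exists p E, [/\ trace_limit p, trace_limit E,
     forall x, `|f x - p x| <= E x & (2 * pi)^-1 * intR (fun t => E (phi t)) <= d]) ->
  trace_limit f.
Proof.
move=> fi approx; split=> //; apply/cvgrPdist_le => d d0.
(* Four quarters: the limit for [p], the limit for [E], and the integral of [E] twice, in comparing
   the traces and in comparing the integrals. *)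
have d4 : 0 < d / 4 by rewrite divr_gt0.
have [p [E [[pI pc] [EI Ec] fpE Ed]]] := approx _ d4.
have pi2 : 0 <= (2 * pi)^-1 :> R by rewrite invr_ge0 mulr_ge0 ?pi_ge0.
near=> N.
have h1 : `|(2 * pi)^-1 * intR (fun t => p (phi t)) -
    (harm N)^-1 * (\sum_(j < N) p (lam j))| <= d / 4.
  by near: N; move/cvgrPdist_le : pc; exact.
have h2 : `|(2 * pi)^-1 * intR (fun t => E (phi t)) -
    (harm N)^-1 * (\sum_(j < N) E (lam j))| <= d / 4.
  by near: N; move/cvgrPdist_le : Ec; exact.
have h3 : `|(harm N)^-1 * (\sum_(j < N) p (lam j)) -
    (harm N)^-1 * (\sum_(j < N) f (lam j))| <= (harm N)^-1 * (\sum_(j < N) E (lam j)).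
  have H0 : 0 <= (harm N)^-1 :> R by rewrite invr_ge0 harm_ge0.
  rewrite -mulrBr normrM (ger0_norm H0) ler_wpM2l// -sumrB.
  apply: le_trans (ler_norm_sum _ _ _) _; apply: ler_sum => j _.
  by rewrite distrC.
have h4 : `|(2 * pi)^-1 * intR (fun t => f (phi t)) -
    (2 * pi)^-1 * intR (fun t => p (phi t))| <= d / 4.
  apply: le_trans Ed; rewrite -mulrBr normrM (ger0_norm pi2) ler_wpM2l// -intRB//.
  apply: le_trans (le_normr_Rintegral _ (integrableRB fi pI)) _ => //.
  by apply: le_intR => //; exact/integrable_norm/integrableRB.
move: h1 h2 h3 h4.
move: ((2 * pi)^-1 * intR (fun t => f (phi t))) ((2 * pi)^-1 * intR (fun t => p (phi t))).
move: ((2 * pi)^-1 * intR (fun t => E (phi t))) Ed.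
move: ((harm N)^-1 * _) ((harm N)^-1 * _) ((harm N)^-1 * _) => x y z u ux v w.
rewrite !ler_norml => /andP[? ?] /andP[? ?] /andP[? ?] /andP[? ?].
by apply/andP; split; lra.
Unshelve. all: by end_near. Qed.

Lemma trace_limit_lipschitz f L : f 0 = 0 ->
  (forall x y, `|f x - f y| <= L * `|x - y|) -> trace_limit f.
Proof.
move=> f0 f_lip.
have L0 : 0 <= L.
  by have := f_lip 1 0; rewrite subr0 normr1 mulr1; exact: le_trans (normr_ge0 _).
have fc : continuous f.
  move=> x; apply/cvgrPdist_le => e e0.
  have L1 : 0 < L + 1 by lra.
  have e1 : 0 < e / (L + 1) by rewrite divr_gt0.
  near=> y; apply: le_trans (f_lip x y) _.
  have xy : `|x - y| <= e / (L + 1).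
    near: y; apply/nbhs_ballP; exists (e / (L + 1)) => /=; first exact: e1.
    by move=> y /= /ltW.
  apply: le_trans (ler_wpM2l L0 xy) _.
  by rewrite mulrA ler_pdivrMr// mulrC ler_wpM2l ?(ltW e0)// lerDl.
have fabs x : `|f x| <= L * `|x| by have := f_lip x 0; rewrite f0 !subr0.
apply: trace_limit_approx.
  apply: le_integrableR (integrableRZ L (integrable_norm phi_int)) => //.
  apply: measurableT_comp; first exact: continuous_measurable_fun.
  exact: integrableR_measurable.
move=> d d0.
(* Mesh 1/(k + 1) and cut-off k + 1 in one parameter. The error is dominated by a multiple of |x|
   and tends to 0 pointwise, hence also in the integral along phi. *)
pose err (k : nat) := interpolation_error L k.+1%:R^-1 k.+1%:R.
have err_limit k : trace_limit (err k).
  apply: trace_limitD; apply: trace_limitZ; last exact: trace_limit_ramp.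
  by apply: trace_limitB; apply: trace_limit_ramp; rewrite ?invr_ge0.
have errN_limit k : trace_limit (fun x => err k (- x)).
  apply: trace_limitD; apply: trace_limitZ; last exact: trace_limit_rampN.
  by apply: trace_limitB; apply: trace_limit_rampN; rewrite ?invr_ge0.
have err_ge0 k x : 0 <= err k x by apply: (interpolation_error_ge0 f_lip); rewrite invr_gt0.
have err_le k x : err k x <= 3 * L * `|x|.
  rewrite /err /interpolation_error.
  have k0 : 0 <= k.+1%:R^-1 :> R by rewrite invr_ge0.
  have r1 := ramp_le_norm x (lexx 0); have r2 := ramp_ge0 k.+1%:R^-1 x.
  have r3 := ramp_le_norm x (ler0n R k.+1).
  have := ler_wpM2l L0 r1; have := ler_wpM2l L0 r3; have := mulr_ge0 L0 r2.
  move=> g1 g2 g3; lra.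
have err_cvg x : err k x @[k --> \oo] --> (0 : R).
  apply: (squeeze_cvgr (f := fun=> 0) (h := fun k => 2 * L * k.+1%:R^-1)).
  - near=> k; rewrite err_ge0/= /err /interpolation_error.
    have k0 : 0 < k.+1%:R^-1 :> R by rewrite invr_gt0.
    rewrite [ramp k.+1%:R x]rampE0 ?mulr0 ?addr0.
      rewrite ler_wpM2l ?mulr_ge0// /ramp subr0.
      move: (k.+1%:R^-1 : R) k0 => v k0.
      by case: (leP x 0) => h1; case: (leP (x - v) 0) => h2; lra.
    apply: (@le_trans _ _ k%:R); last by rewrite ler_nat.
    near: k; exact: nbhs_infty_ger.
  - exact: cvg_cst.
  - rewrite -[X in _ --> X](mulr0 (2 * L)).
    by apply: cvgM; [exact: cvg_cst|exact: invS_cvg0].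
pose E k x := err k x + err k (- x).
have E_limit k : trace_limit (E k) by apply: trace_limitD.
have lim : intR (fun t => E k (phi t)) @[k --> \oo] --> (0 : R).
  rewrite -[X in _ --> X](@intR0 R).
  apply: (intR_cvg (h := fun t => 6 * L * `|phi t|)).
  - by move=> k; apply: integrableR_measurable; case: (E_limit k).
  - by apply: integrableRZ; exact: integrable_norm.
  - move=> k t; rewrite ger0_norm; last exact: addr_ge0 (err_ge0 _ _) (err_ge0 _ _).
    rewrite /E; by have := err_le k (phi t); have := err_le k (- phi t); rewrite normrN => g1 g2; lra.
  - move=> t; rewrite -[X in _ --> X](addr0 0).
    by apply: cvgD; exact: err_cvg.
have pi2 : 0 < (2 * pi)^-1 :> R by rewrite invr_gt0 mulr_gt0 ?pi_gt0.
have d1 : 0 < d * (2 * pi) by rewrite mulr_gt0// -invr_gt0.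
have /cvgrPdist_le /(_ _ d1) [k _ /(_ k (leqnn k))] := lim.
rewrite distrC subr0 => /(le_trans (ler_norm _)) hk.
have k0 : 0 < k.+1%:R^-1 :> R by rewrite invr_gt0.
(* (k + 1)^2 cells of length 1/(k + 1) reach the cut-off k + 1. *)
pose K := (k.+1 * k.+1)%N.
have KE : K%:R * k.+1%:R^-1 = k.+1%:R :> R by rewrite natrM mulfK// pnatr_eq0.
(* The negative axis is treated by reflection; at every point one of the two interpolants
   vanishes. *)
pose fN x := f (- x).
have fN0 : fN 0 = 0 by rewrite /fN oppr0.
have fN_lip x y : `|fN x - fN y| <= L * `|x - y|.
  by apply: le_trans (f_lip _ _) _; rewrite opprK addrC distrC.
exists (fun x => interpolant f k.+1%:R^-1 K x + interpolant fN k.+1%:R^-1 K (- x)).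
exists (E k); split => //.
- apply: trace_limitD.
    apply: trace_limit_sum => i; apply: trace_limitZ.
    by apply: trace_limitB; apply: trace_limit_ramp; rewrite mulr_ge0 ?(ltW k0).
  pose h : R := k.+1%:R^-1.
  apply: (@trace_limit_sum _ _ (fun (i : 'I_K) x =>
    (fN (i.+1%:R * h) - fN (i%:R * h)) / h
    * (ramp (i%:R * h) (- x) - ramp (i.+1%:R * h) (- x)))) => i.
  apply: trace_limitZ.
  by apply: trace_limitB; apply: trace_limit_rampN; rewrite mulr_ge0 ?(ltW k0).
- move=> x; have [x0|x0] := leP 0 x.
    have nx0 : - x <= 0 by rewrite oppr_le0.
    rewrite (interpolant_le0 _ k0 _ nx0) addr0.
    apply: le_trans (interpolantP f0 f_lip k0 K x0) _.
    by rewrite KE /E lerDl.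
  rewrite (interpolant_le0 _ k0 _ (ltW x0)) add0r.
  have nx0 : 0 <= - x by rewrite oppr_ge0 ltW.
  have := interpolantP fN0 fN_lip k0 K nx0; rewrite {1}/fN opprK KE.
  by move/le_trans; apply; rewrite /E lerDr.
- by rewrite ler_pdivrMl ?mulr_gt0 ?pi_gt0// [leRHS]mulrC.
Unshelve. all: by end_near. Qed.

End TraceLimit.
End LipschitzFunctions.

(** * Complex-valued functions and normalization by log N *)

Section ComplexLimit.
Context {R : realType}.

Lemma Re_sub_lipschitz (g : R -> R[i]) (L : R) :
  (forall x y, `|g x - g y| <= (L * `|x - y|)%:C) ->
  forall x y, `|complex.Re (g x) - complex.Re (g y)| <= L * `|x - y|.
Proof.
move=> gl x y; have := gl x y; rewrite normc_def lecR; apply: le_trans.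
case: (g x) (g y) => [a b] [c d] /=.
by rewrite -sqrtr_sqr ler_sqrt ?addr_ge0 ?sqr_ge0// lerDl sqr_ge0.
Qed.

Lemma Im_sub_lipschitz (g : R -> R[i]) (L : R) :
  (forall x y, `|g x - g y| <= (L * `|x - y|)%:C) ->
  forall x y, `|complex.Im (g x) - complex.Im (g y)| <= L * `|x - y|.
Proof.
move=> gl x y; have := gl x y; rewrite normc_def lecR; apply: le_trans.
case: (g x) (g y) => [a b] [c d] /=.
by rewrite -sqrtr_sqr ler_sqrt ?addr_ge0 ?sqr_ge0// lerDr sqr_ge0.
Qed.

Lemma cvg_complex (u v : nat -> R) (a b : R) :
  u n @[n --> \oo] --> a -> v n @[n --> \oo] --> b ->
  (fun n => u n +i* v n) @ \oo --> (a +i* b : R[i]^o).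
Proof.
move=> ua vb; apply/(@cvgrPdist_le R[i] R[i]^o) => -[e e'].
(* Positivity in [R[i]] forces the tolerance to be real. *)
rewrite ltcE /= => /andP[/eqP -> e0].
have e20 : 0 < e / 2 by rewrite divr_gt0.
near=> n.
have h1 : `|a - u n| <= e / 2 by near: n; move/cvgrPdist_le : ua; exact.
have h2 : `|b - v n| <= e / 2 by near: n; move/cvgrPdist_le : vb; exact.
rewrite [X in X <= _]normc_def lecR /=.
rewrite -(ger0_norm (ltW e0)) -sqrtr_sqr ler_sqrt ?sqr_ge0//.
rewrite -[X in X + _]real_normK ?num_real// -[X in _ + X]real_normK ?num_real//.
move: h1 h2 (normr_ge0 (a - u n)) (normr_ge0 (b - v n)); nra.
Unshelve. all: by end_near. Qed.

Lemma harm_ln_cvg : (ln N%:R)^-1 * harm N @[N --> \oo] --> (1 : R).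
Proof.
have lny : ln (N%:R : R) @[N --> \oo] --> +oo.
  apply/cvgryPge => A; near=> N; have -> : A = ln (expR A) by rewrite expRK.
  rewrite ler_ln ?posrE ?expR_gt0//; first by near: N; exact: nbhs_infty_ger.
  by rewrite ltr0n; near: N; exact: nbhs_infty_gt.
apply/cvgrPdist_le => d d0; near=> N.
have N0 : (0 < N)%N by near: N; exact: nbhs_infty_gt.
have l0 : 0 < ln (N%:R : R) by near: N; move/cvgryPgt : lny; exact.
have ld : d^-1 <= ln (N%:R : R) by near: N; move/cvgryPge : lny; exact.
have h1 : ln (N%:R : R) <= harm N.
  by apply: le_trans (harm_ge N); rewrite ler_ln ?posrE ?ltr0n// ler_nat.
have h2 : harm N <= 1 + ln (N%:R : R).
  by move: N0; clear; case: N => // N _; exact: harm_le.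
have -> : 1 - (ln N%:R)^-1 * harm N = - ((harm N - ln N%:R) / ln N%:R) :> R.
  by field; rewrite gt_eqF.
rewrite normrN ger0_norm ?divr_ge0 ?subr_ge0 ?(ltW l0)// ler_pdivrMr//.
apply: (@le_trans _ _ 1); first by lra.
by rewrite -(ler_pM2l d0) divff ?gt_eqF// in ld.
Unshelve. all: by end_near. Qed.

End ComplexLimit.


Theorem theorem2p1 (R : realType) (phi : R -> R) (g : R -> R[i])
    (phi_L1 : lebesgue_measure.-integrable [set: R] (EFin \o phi))
    (g_lip : clipschitz g) (g0 : g 0 = 0) :
  (fun N : nat => ((ln (N%:R : R))^-1)%:C * \tr (hermfun g (Kmx phi N)))
    @ \oo --> (((2 * pi)^-1)%:C * cintegral (fun t => g (phi t)) : R[i]^o).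
Proof.
have [L gL] := g_lip.
pose lam N (j : 'I_N) := complex.Re (spectral_diag (Kmx phi N) 0 j).
have sys N : eigensystem phi (spectralmx (Kmx phi N)) (@lam N).
  exact: spectral_eigensystem.
(* Applied to the real and imaginary parts of [g], which are Lipschitz with the same constant. *)
have limit (f : R -> R) : f 0 = 0 -> (forall x y, `|f x - f y| <= L * `|x - y|) ->
    (ln N%:R)^-1 * (\sum_(j < N) f (lam N j)) @[N --> \oo] -->
    (2 * pi)^-1 * intR (fun t => f (phi t)).
  move=> f0 f_lip; have [_ lim] := trace_limit_lipschitz phi_L1 sys f0 f_lip.
  (* H_N / log N tends to 1, and H_N cancels once it is nonzero. *)
  rewrite -[X in _ --> X]mul1r; apply: cvg_trans (cvgM harm_ln_cvg lim).
  apply: near_eq_cvg; near=> N.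
  have H0 : harm N != 0 :> R.
    by rewrite gt_eqF// harm_gt0//; near: N; exact: nbhs_infty_gt.
  rewrite /= -[LHS]mulrA.
  by rewrite mulVKf.
have reL := limit _ (congr1 (@complex.Re R) g0) (Re_sub_lipschitz gL).
have imL := limit _ (congr1 (@complex.Im R) g0) (Im_sub_lipschitz gL).
have := cvg_complex reL imL.
rewrite /cintegral; set l := (X in _ --> X -> _); set l' := (X in _ -> _ --> X).
have -> : l' = l by rewrite /l /l'; simpc.
apply: cvg_trans; apply: near_eq_cvg; near=> N.
rewrite tr_hermfun.
have -> : \sum_(j < N) g (complex.Re (spectral_diag (Kmx phi N) 0 j)) = (\sum_(j < N) complex.Re (g (lam N j)))
    +i* (\sum_(j < N) complex.Im (g (lam N j))).
  elim/big_rec3: _ => // j x y z _ ->.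
  by case: (g _) => a b; simpc.
by simpc.
Unshelve. all: by end_near. Qed.
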